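(* $\widehat{\mathcal{C}}$ is a dense subgroup of $\widehat{\mathcal{C}}_f$.
   Context: Algebra. Let $\mathbb{C}\langle X_1,X_2,\dots\rangle$ be the associative algebra with unit $I$ of complex noncommutative polynomials in free noncommuting variables $X_1,X_2,\dots$. Let $\mathcal{A}\subset\mathbb{C}\langle X_1,X_2,\dots\rangle[[t]]$ be the subalgebra of formal power series of the form $f=c_0I+\sum_{n\ge1}\big(\sum_{i_1+\cdots+i_k=n}c_{i_1,\dots,i_k}X_{i_1}\cdots X_{i_k}\big)t^n$ with complex coefficients (inner sum over all $k\ge1$ and all $(i_1,\dots,i_k)\in\mathbb{N}^k$ with sum $n$). Equip $\mathcal{A}$ with the weakest topology making all coefficient functions continuous. Let $G\subset\mathcal{A}$ be the topological group (under multiplication) of elements with $c_0=1$. Paths. Fix $T>0$, $I_T=[0,T]$. $X$ is the set of sequences $a=(a_1,a_2,\dots)$ of complex-valued functions $a_i\in L^\infty(I_T)$ with $\sup_{x\in I_T,\,i\in\mathbb{N}}|a_i(x)|^{1/i}<\infty$. For $a\in X$ let $F_a:I_T\to G$ be the solution (by Picard iteration, with coefficients Lipschitz in $x$) of $F'(x)=\big(\sum_{i\ge1}a_i(x)t^iX_i\big)F(x)$, $F_a(0)=I$, and set $E(a)=F_a(T)\in G$. $G(X):=E(X)$ is a subgroup of $G$, and the group of formal paths $G_f(X)$ is its closure in $G$ (the paper defines these as a quotient of $X$ and its completion and identifies them with these subgroups). Centers. The equation $\frac{dv}{dx}=\sum_{i=1}^{\infty}a_i(x)v^{i+1}$, $x\in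 I_T$, with $a\in X$, determines a center if every (Lipschitz) solution $v$ with a sufficiently small initial value satisfies $v(T)=v(0)$. $\mathcal{C}\subset X$ is the set of $a\in X$ determining a center, and $\widehat{\mathcal{C}}:=E(\mathcal{C})\subset G(X)$ is the group of centers. Formal centers. For $a\in X$ let $I_{i_1,\dots,i_k}(a)=\int\cdots\int_{0\le s_1\le\cdots\le s_k\le T}a_{i_k}(s_k)\cdots a_{i_1}(s_1)\,ds_k\cdots ds_1$, and let $\widehat I_{i_1,\dots,i_k}$ be the unique continuous function on $G_f(X)$ with $\widehat I_{i_1,\dots,i_k}(E(a))=I_{i_1,\dots,i_k}(a)$, $a\in X$. Let $p_{i_1,\dots,i_k}(t)=(t-i_1+1)(t-i_1-i_2+1)\cdots(t-i_1-\cdots-i_k+1)$. Let $G[[r]]$ be the group of formal complex power series $r+\sum_{i\ge1}d_ir^{i+1}$ under composition. The map $\widehat P:G_f(X)\to G[[r]]$, $$\widehat P(g)=r+\sum_{i=1}^{\infty}\Big(\sum_{i_1+\cdots+i_k=i}p_{i_1,\dots,i_k}(i)\,\widehat I_{i_1,\dots,i_k}(g)\Big)r^{i+1},$$ is a group homomorphism; $\widehat{\mathcal{C}}_f:=\ker\widehat P$ is the group of formal centers. It carries the topology induced from $G_f(X)$. *)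

(* Defs.v *)
From HB Require Import structures.
From mathcomp Require Export all_boot all_order all_algebra.
From mathcomp Require Export all_classical all_reals all_analysis.
From mathcomp Require Export complex.

Set Implicit Arguments.
Unset Strict Implicit.
Unset Printing Implicit Defensive.

Import Order.TTheory GRing.Theory Num.Theory.
Export numFieldNormedType.Exports.

Local Open Scope classical_set_scope.
Local Open Scope ring_scope.

(* Index convention.  The indices 1, 2, 3, ... of the variables X_i and of the
   coefficients a_i are shifted by one: the natural number j stands for the
   index j + 1.  A word [:: j1; ...; jk] therefore stands for the multi-index
   (j1 + 1, ..., jk + 1), i.e. for the monomial X_(j1+1) ... X_(jk+1). *)

Section FormalPaths.
Variable R : realType.

(* The complex numbers, as a numFieldType so that they carry the topology that
   the library attaches to numeric fields. *)
Definition Cplx : numFieldType := R[i].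

Notation mu := (@lebesgue_measure R).

Definition word := seq nat.

Definition weight (w : word) : nat := (\sum_(j <- w) j.+1)%N.

(* In an element of the algebra A the coefficient of t^n only involves words of
   weight n, so an element is the same as the family of the coefficients c_w of
   w * t^(weight w), w ranging over all words ([::] carries c_0).  The weakest
   topology making all coefficient functions continuous is the product
   topology. *)
Definition ncseries := {ptws word -> Cplx}.

Definition ncone : ncseries := fun w => (w == [::])%:R.

Definition ncmul (f g : ncseries) : ncseries :=
  fun w => \sum_(k < (size w).+1) f (take k w) * g (drop k w).

Definition ncgroup : set ncseries := [set f | f [::] = 1].

Definition is_subgroup (H : set ncseries) : Prop :=
  [/\ H `<=` ncgroup,
      H ncone,
      forall f g, H f -> H g -> H (ncmul f g) &
      forall f, H f ->
        exists g, [/\ H g, ncmul f g = ncone & ncmul g f = ncone]].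

Definition cderive (f : R -> Cplx) (x : R) (l : Cplx) : Prop :=
  is_derive x (1 : R) (fun s => complex.Re (f s) : R^o) (complex.Re l) /\
  is_derive x (1 : R) (fun s => complex.Im (f s) : R^o) (complex.Im l).

Definition clipschitz (D : set R) (f : R -> Cplx) : Prop :=
  [lipschitz (complex.Re (f x) : R^o) | x in (D : set R^o)] /\
  [lipschitz (complex.Im (f x) : R^o) | x in (D : set R^o)].

Definition cintegral (D : set R) (f : R -> Cplx) : Cplx :=
  ((\int[mu]_(x in D) complex.Re (f x)) +i* (\int[mu]_(x in D) complex.Im (f x)))%C.

Definition Linfty (D : set R) (f : R -> Cplx) : Prop :=
  [/\ measurable_fun D (fun x => complex.Re (f x)),
      measurable_fun D (fun x => complex.Im (f x)) &
      exists M : R, {ae mu, forall x, D x -> Normc.normc (f x) <= M}].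

Variable T : R.
Notation IT := (`[0, T]%classic : set R).

Definition coefs := nat -> R -> Cplx.

(* L^oo functions are given by representatives, and the supremum over x is the
   essential one. *)
Definition X : set coefs :=
  [set a | (forall j, Linfty IT (a j)) /\
     exists M : R, forall j,
       {ae mu, forall x, IT x -> Normc.normc (a j x) `^ (j.+1%:R)^-1 <= M}].

(* sum_(i >= 1) a_i(x) t^i X_i *)
Definition generator (a : coefs) (x : R) : ncseries :=
  fun w => if w is [:: j] then a j x else 0.

(* As the a_i are only L^oo, the differential equation holds for almost every
   x, coefficient by coefficient. *)
Definition path_solution (a : coefs) (F : R -> ncseries) : Prop :=
  [/\ F 0 = ncone,
      forall w, clipschitz IT (fun x => F x w) &
      forall w, {ae mu, forall x, IT x ->
        cderive (fun s => F s w) x (ncmul (generator a x) (F x) w)}].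

(* The values of F outside [0, T] are irrelevant. *)
Definition path_of (a : coefs) : R -> ncseries :=
  xget (fun=> ncone) [set F | path_solution a F].

Definition E (a : coefs) : ncseries := path_of a T.

Definition GX : set ncseries := E @` X.

Definition GfX : set ncseries := ncgroup `&` closure GX.

Definition ode_solution (a : coefs) (v : R -> Cplx) : Prop :=
  clipschitz IT v /\
  {ae mu, forall x, IT x -> exists l : Cplx,
     (series (fun j => a j x * v x ^+ j.+2) @ \oo --> l) /\ cderive v x l}.

Definition determines_center (a : coefs) : Prop :=
  exists2 eps : R, 0 < eps &
    forall v, ode_solution a v -> Normc.normc (v 0) < eps -> v T = v 0.

Definition center_set : set coefs := [set a | X a /\ determines_center a].

Definition Chat : set ncseries := E @` center_set.

(* iterated_from a [:: i1; ...; ik] lo is the integral of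
   a_ik(s_k) ... a_i1(s_1) ds_k ... ds_1 over lo <= s_1 <= ... <= s_k <= T,
   s_1 being the outermost variable. *)
Fixpoint iterated_from (a : coefs) (w : word) (lo : R) : Cplx :=
  if w is j :: w' then
    cintegral `[lo, T] (fun s => a j s * iterated_from a w' s)
  else 1.

Definition iterated (w : word) (a : coefs) : Cplx := iterated_from a w 0.

(* Only the values on GfX, where the extension is unique, are meaningful. *)
Definition Ihat (w : word) : ncseries -> Cplx :=
  xget (fun=> 0)
    [set f : ncseries -> Cplx | {within GfX, continuous f} /\
                   forall a, X a -> f (E a) = iterated w a].

Definition pcoef (w : word) (t : Cplx) : Cplx :=
  \prod_(m < size w) (t - (weight (take m.+1 w))%:R + 1).

(* A formal power series in r is the sequence of its coefficients. *)
Definition fpseries := nat -> Cplx.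

Definition fps_id : fpseries := fun n => (n == 1)%:R.

(* The multi-indices of sum i are the words of weight i; such a word has
   length at most i and shifted letters smaller than i. *)
Definition Phat (g : ncseries) : fpseries := fun n =>
  match n with
  | 0 => 0
  | 1 => 1
  | i.+1 =>
      \sum_(k < i.+1) \sum_(w : k.-tuple 'I_i | weight (map val w) == i)
        pcoef (map val w) i%:R * Ihat (map val w) g
  end.

Definition Chat_f : set ncseries := [set g | GfX g /\ Phat g = fps_id].

(* For S included in K: S is dense in K for the topology induced on K. *)
Definition dense_in (K S : set ncseries) : Prop := K `<=` closure S.

Definition is_dense_subgroup (K S : set ncseries) : Prop :=
  [/\ S `<=` K, is_subgroup S & dense_in K S].

End FormalPaths.

(* Main.v *)
(* For a path a, let F(x, r) = sum_n S_n(x) r^(n+1) be the flow of the equation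
   from time x to time T.  Its coefficients solve the linear transport system
   dual to the equation, with the iterated integrals of a as solution, so that
   sum_n S_n(0) r^(n+1) is at once the formal series Phat (E a) and, by a
   Cauchy-Kovalevskaya type bound, the convergent first return map of a.  A
   center therefore lies in the kernel of Phat.

   Density: given g in the kernel of Phat, choose a path a with E a close to g,
   up to a given weight.  Its return map P(r) = r + q(r) then has small low
   order coefficients.  The function U(x, y) = y + (x/T) q(y) is a first integral
   of the equation with right-hand side - U_x / U_y, whose coefficients b_j are
   again geometrically bounded and are small in low order.  The return map of b
   is the inverse of P, so b followed by a is a center, and E a * E b is close to
   E a. *)

Require Import Defs.
From mathcomp Require Import ring lra zify measurable_realfun.

Set Implicit Arguments.
Unset Strict Implicit.
Unset Printing Implicit Defensive.

Import Order.TTheory GRing.Theory Num.Theory.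

Local Open Scope classical_set_scope.
Local Open Scope ring_scope.

(** * Lipschitz functions and their almost everywhere derivatives *)

(** Why U inverts the return map: U(0, y) = y and U(T, y) = P(y), so a small solution of the
    equation of b satisfies v(0) = P(v(T)). The coefficients of U in y solve the transport system of
    b, just as those of the flow of a solve the system of a. One estimate therefore serves both
    halves of the concatenated path, and no inverse series is formed. Why q is small in low order:
    on formal paths, each coefficient of [Phat] is a fixed finite linear combination of coefficients
    of the path, all of one weight. At g it vanishes, so at E a it is controlled by E a - g. In high
    order q is not small; there its geometric bound is what puts b into [X]. The analytic obstacle
    is that the a_i are only measurable and essentially bounded: equations hold almost everywhere
    and solutions are merely Lipschitz. Uniqueness, growth estimates and majorants are all drawn
    from one monotonicity statement, [ae_derive_ge0_le]. *)

Section RealCore.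
Variable R : realType.
Notation mu := (@lebesgue_measure R).

(** The supremum of the points up to which [P] holds throughout can be reached by the limit
    hypothesis and, short of the target, passed by the step hypothesis. This is the form of
    continuation argument used for monotonicity and for a priori bounds. *)
Lemma real_induction (a b : R) (P : R -> Prop) :
  P a ->
  (forall x, a <= x < b -> P x ->
    exists2 e : R, 0 < e & forall y, x < y < x + e -> P y) ->
  (forall x, a < x <= b -> (forall y, a <= y < x -> P y) -> P x) ->
  forall x, a <= x <= b -> P x.
Proof.
move=> Pa Pstep Plim x0 /andP[ax0 x0b].
pose A := [set y | a <= y <= x0 /\ forall z, a <= z <= y -> P z].
have Aa : A a.
  split; first by rewrite lexx.
  by move=> z; rewrite -eq_le => /eqP <-.
have supA : has_sup A.
  by split; [exists a | exists x0 => y -[/andP[]]].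
set s := sup A.
have as_ : a <= s by apply: ub_le_sup => //; exact: (supA.2).
have sx0 : s <= x0 by apply: ge_sup => [|y [/andP[]]] //; exists a.
have Plt y : a <= y < s -> P y.
  move=> /andP[ay ys].
  have [|z [zb Az] yz] := @sup_adherent _ _ (s - y) _ supA; first by rewrite subr_gt0.
  by apply: Az; rewrite ay ltW// (le_lt_trans _ yz)// opprB addrC subrK.
have Ps : P s.
  move: as_; rewrite le_eqVlt => /predU1P[<-//|as_].
  by apply: Plim => //; rewrite as_ (le_trans sx0).
move: sx0; rewrite le_eqVlt => /predU1P[<-//|sx0].
have [|e e0 Pe] := Pstep s _ Ps; first by rewrite as_ (lt_le_trans sx0).
pose y := Num.min x0 (s + e / 2).
have sy : s < y by rewrite lt_min sx0 ltrDl divr_gt0.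
suff : A y by move=> /(ub_le_sup (proj2 supA)); rewrite leNgt sy.
split; first by rewrite ge_min lexx (le_trans as_ (ltW sy)).
move=> z /andP[az zy]; have [zs|] := ltP z s; first by apply: Plt; rewrite az.
rewrite le_eqVlt => /predU1P[<-//|sz]; apply: Pe; rewrite sz (le_lt_trans zy)//.
by rewrite gt_min ltrD2l ltr_pdivrMr// mulr_natr mulr2n ltrDl e0 orbT.
Qed.

Lemma derive_ge0_right (h : R -> R) (x l e : R) : is_derive x (1 : R) (h : R -> R^o) l ->
  0 <= l -> 0 < e ->
  exists2 d : R, 0 < d & forall y, x < y < x + d -> h x - e * (y - x) <= h y.
Proof.
move=> [dh hl] l0 e0.
have := dh; rewrite /derivable => /cvg_ex [l' hl'].
have ll' : l' = l by rewrite -hl; apply/esym/cvg_lim => //; exact: hl'.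
move/cvgrPdist_lt : hl' => /(_ e e0)[d /= d0 dP].
exists d => // y /andP[xy yd].
have yx0 : y - x != 0 by rewrite subr_eq0 gt_eqF.
have := dP (y - x).
rewrite /ball_/= sub0r normrN gtr0_norm ?subr_gt0// ltrBlDl => /(_ yd yx0).
rewrite /GRing.scale/= mulr1 subrK ll' => H.
have : l - (y - x)^-1 * (h y - h x) < e by rewrite (le_lt_trans (ler_norm _))//.
move=> {}H.
have yx : 0 < y - x by rewrite subr_gt0.
have : (y - x)^-1 * (h y - h x) > - e by lra.
rewrite -(ltr_pM2l yx) mulrA mulfV// mul1r mulrN => H1.
by rewrite lerBlDr -lerBlDl; lra.
Qed.

(** The exceptional null set lies in an open [U] of measure at most [e]. With [m x] the measure of
    [U] up to [x], continuation shows that h(x) + e (x - a) + K m(x) never drops below its initial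
    value: inside [U] the term K m pays for the Lipschitz loss, outside [U] the derivative is
    nonnegative and e (x - a) pays for the error of the difference quotient. *)
Lemma ae_derive_ge0_le (h : R -> R) (K a b : R) : a <= b -> 0 <= K ->
  (forall x y, a <= x <= y -> y <= b -> `|h y - h x| <= K * (y - x)) ->
  {ae mu, forall x, a <= x <= b ->
     exists2 l, 0 <= l & is_derive x (1 : R) (h : R -> R^o) l} ->
  h a <= h b.
Proof.
move=> ab K0 hK [N [mN N0 NP]].
apply/ler_addgt0Pr => e0 e0_gt0.
(* The total loss is at most [e * (b - a) + K * e], which this [C] keeps below [e0]. *)
pose C := (b - a) + K + 1.
have C0 : 0 < C by rewrite /C; lra.
pose e := e0 / C.
have e_gt0 : 0 < e by rewrite divr_gt0.
have [|U [oU NU mUN]] := @lebesgue_regularity_outer R N e mN _ e_gt0.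
  by rewrite [X in (X < _)%E]N0 ltry.
have mU : measurable U by exact: measurable_realfun.open_measurable.
have muU : (mu U <= e%:E)%E.
  rewrite -(setDUK NU) measureU//; last 2 first.
  - exact: measurableD.
  - by rewrite setDIK.
  by rewrite [X in (X + _)%E]N0 add0e ltW.
pose m x := fine (mu (U `&` `[a, x])).
have mfin x : mu (U `&` `[a, x]) \is a fin_num.
  rewrite ge0_fin_numE//; apply: (@le_lt_trans _ _ (e%:E)); last by rewrite ltry.
  apply: le_trans muU; apply: le_measure; rewrite ?inE//; exact: measurableI.
have m_mono x y : x <= y -> m x <= m y.
  move=> xy; apply: fine_le => //.
  apply: le_measure; rewrite ?inE; try exact: measurableI.
  apply: setIS => z /=; rewrite !in_itv/= => /andP[-> zx]; exact: le_trans xy.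
have m_U x y : a <= x -> x <= y -> (forall z, x < z <= y -> U z) -> m x + (y - x) <= m y.
  move=> ax xy Uxy.
  have Exy : mu `]x, y] = (y - x)%:E.
    rewrite lebesgue_measure_itv/= lte_fin; move: xy; rewrite le_eqVlt => /predU1P[->|->].
      by rewrite ltxx subrr.
    by [].
  have -> : m x + (y - x) = fine (mu ((U `&` `[a, x]) `|` `]x, y])).
    rewrite measureU//; last 2 first.
      exact: measurableI.
      rewrite -subset0 => z []/= [_]; rewrite !in_itv/= => /andP[_ zx] /andP[xz _].
      by move: (lt_le_trans xz zx); rewrite ltxx.
    by rewrite [X in (_ + X)%E]Exy fineD// mfin.
  apply: fine_le => //.
  - rewrite ge0_fin_numE// (le_lt_trans (measureU2 _ _ _))//; try exact: measurableI.
    rewrite lte_add_pinfty// ?ltey_eq ?mfin//.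
    by rewrite [X in X \is a fin_num]Exy.
  - apply: le_measure; rewrite ?inE; try exact: measurableI.
      by apply: measurableU => //; exact: measurableI.
    move=> z [[Uz]|]/=; rewrite !in_itv/= => /andP[].
      by move=> az zx; split => //; rewrite az (le_trans zx).
    by move=> xz zy; split; [apply: Uxy; rewrite xz|rewrite zy (le_trans ax)// ltW].
have m0 x : 0 <= m x by exact: fine_ge0.
suff : h a - e * (b - a) - K * m b <= h b.
  have mb : m b <= e.
    rewrite -lee_fin fineK//; apply: le_trans muU.
    by apply: le_measure; rewrite ?inE//; exact: measurableI.
  have Kmb : K * m b <= K * e by exact: ler_wpM2l.
  move=> H; rewrite -lerBlDr; apply: le_trans H.
  have -> : e0 = e * C by rewrite /e mulfVK// gt_eqF.
  rewrite /C; nra.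
pose P x := h a - e * (x - a) - K * m x <= h x.
apply: (@real_induction a b P) => //.
- rewrite /P subrr mulr0 subr0 lerBlDr lerDl; exact: mulr_ge0.
- move=> x /andP[ax xb] Px.
  have [Ux|nUx] := pselect (U x).
    have [d/= d0 dU] := oU _ Ux.
    exists (Num.min d (b - x)); first by rewrite lt_min d0 subr_gt0.
    move=> y /andP[xy yx].
    have yb : y <= b by have : y - x < b - x by [move: yx; rewrite -ltrBlDl lt_min => /andP[]]; lra.
    have yd : y - x < d by move: yx; rewrite -ltrBlDl lt_min => /andP[].
    have hxy : `|h y - h x| <= K * (y - x) by apply: hK => //; rewrite ax ltW.
    have mxy : m x + (y - x) <= m y.
      apply: m_U => //; first exact: ltW.
      move=> z /andP[xz zy]; apply: dU => /=; rewrite /ball_/= distrC gtr0_norm ?subr_gt0//; lra.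
    move: Px; rewrite /P; move: hxy; rewrite ler_norml => /andP[H _].
    have := ler_wpM2l K0 mxy; have : 0 <= e * (y - x) by rewrite mulr_ge0// ltW// subr_gt0.
    by rewrite !mulrDr !mulrN; lra.
  have [l l0 hl] : exists2 l, 0 <= l & is_derive x (1 : R) (h : R -> R^o) l.
    apply: contrapT => H; apply: nUx; apply: NU; apply: NP => /= /(_ _)H1.
    by apply: H; apply: H1; rewrite ax ltW.
  have [d d0 dP] := derive_ge0_right hl l0 e_gt0.
  exists d => // y xyd; have H := dP y xyd; rewrite /P.
  have := ler_wpM2l K0 (m_mono x y (ltW (proj1 (andP xyd)))).
  by move: Px H; rewrite /P !mulrDr !mulrN; lra.
- move=> x /andP[ax xb] Py.
  apply/ler_addgt0Pr => d d0.
  pose y := Num.max a (x - d / (K + 1)).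
  have K1 : 0 < K + 1 by lra.
  have dK : 0 < d / (K + 1) by rewrite divr_gt0.
  have ay : a <= y by rewrite le_max lexx.
  have yx : y < x by rewrite gt_max ax ltrBlDr ltrDl.
  have xy : x - y <= d / (K + 1) by rewrite lerBlDr -lerBlDl le_max lexx orbT.
  have Kd : K * (x - y) <= d.
    rewrite (le_trans (ler_wpM2l K0 xy))// mulrCA -[leRHS]mulr1 ler_wpM2l ?ltW//.
    by rewrite ltr_pdivrMr// mul1r ltrDl.
  have := Py y; rewrite ay yx => /(_ isT); rewrite /P.
  have : `|h x - h y| <= K * (x - y) by apply: hK => //; rewrite ay ltW.
  rewrite ler_norml => /andP[+ _].
  have := ler_wpM2l K0 (m_mono _ _ (ltW yx)).
  have : e * (y - a) <= e * (x - a) by rewrite ler_wpM2l// ?lerD2r ltW.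
  lra.
- by rewrite ab lexx.
Qed.

End RealCore.

(** * Integrals of bounded measurable functions as Lipschitz primitives *)

Section Antiderivative.
Variable R : realType.
Notation mu := (@lebesgue_measure R).

Lemma ae_weaken (P Q : R -> Prop) : (forall x, P x -> Q x) ->
  {ae mu, forall x, P x} -> {ae mu, forall x, Q x}.
Proof.
by move=> PQ; apply: filterS; first exact: (ae_filter_ringOfSetsType mu).
Qed.

Lemma ae_conj (P Q : R -> Prop) : {ae mu, forall x, P x} -> {ae mu, forall x, Q x} ->
  {ae mu, forall x, P x /\ Q x}.
Proof.
by move=> aP aQ; apply: filterI => //; exact: (ae_filter_ringOfSetsType mu).
Qed.

Lemma is_derive_local (f g : R -> R) (a b x l : R) : a < x < b ->
  (forall y, a <= y <= b -> f y = g y) ->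
  is_derive x (1 : R) (f : R -> R^o) l -> is_derive x (1 : R) (g : R -> R^o) l.
Proof.
move=> /andP[ax xb] fg; apply: near_eq_is_derive => //.
have : \forall y \near x, y \in `]a, b[.
  by apply: near_in_itvoo; rewrite in_itv/= ax.
apply: filterS => y; rewrite in_itv/= => /andP[ay yb].
by rewrite fg// !ltW.
Qed.

Lemma ae_bounded_le (D : set R) (f : R -> R) (K : R) :
  measurable D -> measurable_fun D f ->
  {ae mu, forall x, D x -> `|f x| <= K} ->
  (\int[mu]_(x in D) `|(f x)%:E| <= `|K|%:E * mu D)%E.
Proof.
move=> mD mf fK; apply: integral_le_bound => //; first exact/measurable_EFinP.
apply: ae_weaken fK => x fK Dx; rewrite lee_fin.
by rewrite (le_trans (fK Dx))// ler_norm.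
Qed.

Lemma ae_bounded_integrable (D : set R) (f : R -> R) (K : R) :
  measurable D -> (mu D < +oo)%E -> measurable_fun D f ->
  {ae mu, forall x, D x -> `|f x| <= K} ->
  mu.-integrable D (EFin \o f).
Proof.
move=> mD muD mf fK; apply/integrableP; split; first exact/measurable_EFinP.
apply: le_lt_trans (ae_bounded_le mD mf fK) _.
by rewrite lte_mul_pinfty.
Qed.

Lemma ae_sub (A B : set R) (P : R -> Prop) : B `<=` A ->
  {ae mu, forall x, A x -> P x} -> {ae mu, forall x, B x -> P x}.
Proof. by move=> BA; apply: ae_weaken => x AP /BA. Qed.

Variables (a b : R) (f : R -> R) (K : R).
Hypothesis mf : measurable_fun `[a, b] f.
Hypothesis fK : {ae mu, forall x, `[a, b]%classic x -> `|f x| <= K}.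

Lemma itv_integrable (i : interval R) : [set` i] `<=` `[a, b] ->
  mu.-integrable [set` i] (EFin \o f).
Proof.
move=> iab.
have : mu.-integrable `[a, b] (EFin \o f).
  apply: (@ae_bounded_integrable _ _ K) => //.
  by rewrite lebesgue_measure_itv/=; case: ifP; rewrite ltry.
by apply: integrableS.
Qed.

Lemma antideriv_lipschitz x y : a <= x <= y -> y <= b ->
  `|\int[mu]_(t in `[a, y]) f t - \int[mu]_(t in `[a, x]) f t| <= `|K| * (y - x).
Proof.
move=> /andP[ax xy] yb.
have sub : [set` `]x, y]] `<=` `[a, b].
  move=> z /=; rewrite !in_itv/= => /andP[xz zy].
  by rewrite (le_trans ax (ltW xz)) (le_trans zy).
rewrite Rintegral_itvB//; last first.
  apply: itv_integrable => z /=; rewrite !in_itv/= => /andP[-> zy].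
  exact: (le_trans zy).
apply: le_trans (le_normr_Rintegral _ _) _ => //; first exact: itv_integrable.
have := ae_bounded_le (measurable_itv `]x, y]) (measurable_funS _ sub mf) (ae_sub sub fK).
move=> /(_ (measurable_itv _)).
have -> : (mu `]x, y] = (y - x)%:E).
  rewrite lebesgue_measure_itv/= lte_fin; move: xy; rewrite le_eqVlt => /predU1P[->|->].
    by rewrite ltxx subrr.
  by [].
rewrite -EFinM => H; rewrite -lee_fin fineK//.
rewrite ge0_fin_numE ?integral_ge0//.
by apply: le_lt_trans H _; rewrite ltry.
Qed.

Lemma antideriv_ae_derive :
  {ae mu, forall x, a < x < b ->
    is_derive x (1 : R) (fun x => (\int[mu]_(t in `[a, x]) f t) : R^o) (f x)}.
Proof.
have fi : mu.-integrable `[a, b] (EFin \o f) by exact: itv_integrable.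
(* Lebesgue differentiation is applied to the extension of [f] by zero; inside the interval both
   have the same primitive. *)
have lf : locally_integrable setT (f \_ `[a, b]) by exact: integrable_locally.
have gi : mu.-integrable setT (EFin \o (f \_ `[a, b])).
  by rewrite -restrict_EFin; apply/integrable_restrict => //=; rewrite setTI.
have := FTC1 (a := BLeft a) _ lf => /(_ _)/=.
have gi' y : mu.-integrable `[a, y] (EFin \o (f \_ `[a, b])) by exact: integrableS gi.
move=> /(_ gi'); apply: ae_weaken => x + /andP[ax xb].
rewrite lte_fin => /(_ ax)[df df1].
apply: (@is_derive_local (fun y => \int[mu]_(t in `[a, y]) (f \_ `[a, b]) t) _ a b).
- by rewrite ax.
- move=> y /andP[ay yb]; apply: eq_Rintegral => t; rewrite inE/= in_itv/= => /andP[at_ ty].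
  by rewrite patchE ifT// inE/= in_itv/= at_ (le_trans ty).
- have -> : f x = (f \_ `[a, b]) x by rewrite patchE ifT// inE/= in_itv/= !ltW.
  by rewrite -df1 derive1E; exact: DeriveDef.
Qed.

End Antiderivative.

(** * Real parts, imaginary parts and the modulus *)

Section ComplexNorm.
Variable R : realType.
Implicit Types z w : Cplx R.
Notation nrm := (@Normc.normc R).
Notation Re := (@complex.Re R).
Notation Im := (@complex.Im R).

Definition toC (x : R) : Cplx R := (x +i* 0)%C.

Lemma Re_add z w : Re (z + w) = Re z + Re w. Proof. by case: z w => [? ?] []. Qed.
Lemma Im_add z w : Im (z + w) = Im z + Im w. Proof. by case: z w => [? ?] []. Qed.
Lemma Re_opp z : Re (- z) = - Re z. Proof. by case: z. Qed.
Lemma Im_opp z : Im (- z) = - Im z. Proof. by case: z. Qed.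
Lemma Re_mul z w : Re (z * w) = Re z * Re w - Im z * Im w.
Proof. by case: z w => [? ?] []. Qed.
Lemma Im_mul z w : Im (z * w) = Re z * Im w + Im z * Re w.
Proof. by case: z w => [? ?] [? ?]. Qed.
Lemma cplx_eq z w : Re z = Re w -> Im z = Im w -> z = w.
Proof. by case: z w => [? ?] [? ?] /= -> ->. Qed.

Lemma nrm_ge0 z : 0 <= nrm z. Proof. by case: z => *; exact: sqrtr_ge0. Qed.
Lemma nrm0 : nrm (0 : Cplx R) = 0. Proof. exact: Normc.normc0. Qed.
Lemma nrm1 : nrm (1 : Cplx R) = 1. Proof. exact: Normc.normc1. Qed.
Lemma nrmM z w : nrm (z * w) = nrm z * nrm w. Proof. exact: Normc.normcM. Qed.
Lemma nrmD z w : nrm (z + w) <= nrm z + nrm w. Proof. exact: le_normcD. Qed.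
Lemma nrmN z : nrm (- z) = nrm z. Proof. exact: normcN. Qed.
Lemma nrmB z w : nrm (z - w) <= nrm z + nrm w.
Proof. by rewrite (le_trans (nrmD _ _))// nrmN. Qed.
Lemma nrm_dist z w : nrm (z - w) = nrm (w - z).
Proof. by rewrite -nrmN opprB. Qed.
Lemma nrm_eq0 z : nrm z = 0 -> z = 0. Proof. exact: Normc.eq0_normc. Qed.
Lemma nrmX z n : nrm (z ^+ n) = nrm z ^+ n.
Proof. by elim: n => [|n IH]; rewrite ?expr0 ?nrm1// !exprS nrmM IH. Qed.
Lemma nrm_toC (x : R) : nrm (toC x) = `|x|.
Proof. by rewrite /= expr0n/= addr0 sqrtr_sqr. Qed.
Lemma nrm_sum (I : Type) (r : seq I) (P : pred I) (F : I -> Cplx R) :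
  nrm (\sum_(i <- r | P i) F i) <= \sum_(i <- r | P i) nrm (F i).
Proof.
elim/big_rec2 : _ => [|i y x _ H]; first by rewrite nrm0.
by rewrite (le_trans (nrmD _ _))// lerD2l.
Qed.
Lemma nrm_Re z : `|Re z| <= nrm z.
Proof.
by case: z => a b /=; rewrite -sqrtr_sqr ler_sqrt ?lerDl ?addr_ge0 ?sqr_ge0.
Qed.
Lemma nrm_Im z : `|Im z| <= nrm z.
Proof.
by case: z => a b /=; rewrite -sqrtr_sqr ler_sqrt ?lerDr ?addr_ge0 ?sqr_ge0.
Qed.
Lemma nrm_le z : nrm z <= `|Re z| + `|Im z|.
Proof.
case: z => a b /=; rewrite -[leRHS]ger0_norm ?addr_ge0// -sqrtr_sqr.
rewrite ler_sqrt ?sqr_ge0// sqrrD !real_normK ?num_real//.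
by rewrite lerD2r lerDl mulrn_wge0// mulr_ge0.
Qed.
Lemma nrmV z : nrm z^-1 = (nrm z)^-1. Proof. exact: Normc.normcV. Qed.
(** Turns a bound on a modulus into a bound on one real part, to which the real monotonicity lemma
    applies. *)
Lemma nrm_rotate z : exists2 u : Cplx R, nrm u = 1 & u * z = toC (nrm z).
Proof.
have [->|z0] := eqVneq z 0; first by exists 1; rewrite ?nrm1// nrm0 mulr0.
have nz : nrm z != 0 by apply: contra_neq z0 => /nrm_eq0.
exists (toC (nrm z) * z^-1); last by rewrite mulfVK.
by rewrite nrmM nrmV nrm_toC ger0_norm ?nrm_ge0// mulfV.
Qed.

Lemma toCD x y : toC (x + y) = toC x + toC y.
Proof. by apply: cplx_eq => /=; rewrite ?addr0. Qed.
Lemma toCN x : toC (- x) = - toC x.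
Proof. by apply: cplx_eq => /=; rewrite ?oppr0. Qed.
Lemma toCM x y : toC (x * y) = toC x * toC y.
Proof. by apply: cplx_eq => /=; rewrite ?mulr0 ?mul0r ?subr0 ?addr0. Qed.
Lemma toC0 : toC 0 = 0. Proof. by []. Qed.
Lemma toC1 : toC 1 = 1. Proof. by []. Qed.
Lemma toCX x n : toC (x ^+ n) = toC x ^+ n.
Proof. by elim: n => // n IH; rewrite !exprS toCM IH. Qed.
Lemma toC_nat n : toC n%:R = n%:R.
Proof. by elim: n => // n IH; rewrite -[n.+1]addn1 !natrD toCD IH. Qed.
Lemma nrm_nat n : nrm (n%:R : Cplx R) = n%:R.
Proof. by rewrite -toC_nat nrm_toC normr_nat. Qed.
Lemma toCV x : toC x^-1 = (toC x)^-1.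
Proof.
have [->|x0] := eqVneq x 0; first by rewrite invr0 toC0 invr0.
have cx0 : toC x != 0 by apply: contra_neq x0 => -[].
by apply: (mulIf cx0); rewrite -toCM !mulVf.
Qed.

End ComplexNorm.

(** * Lipschitz functions with a prescribed almost everywhere derivative *)

Section Primitive.
Variable R : realType.
Notation mu := (@lebesgue_measure R).
Notation C := (Cplx R).
Notation nrm := (@Normc.normc R).
Notation Re := (@complex.Re R).
Notation Im := (@complex.Im R).

Lemma cderive_cst (c : C) x : cderive (fun=> c) x 0.
Proof. by split => /=; exact: is_derive_cst. Qed.

Lemma cderiveD (f g : R -> C) x a b : cderive f x a -> cderive g x b ->
  cderive (fun s => f s + g s) x (a + b).
Proof.
move=> [f1 f2] [g1 g2]; split; rewrite ?Re_add ?Im_add.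
  under eq_fun do rewrite Re_add; exact: is_deriveD.
under eq_fun do rewrite Im_add; exact: is_deriveD.
Qed.

Lemma cderiveM (f g : R -> C) x a b : cderive f x a -> cderive g x b ->
  cderive (fun s => f s * g s) x (a * g x + f x * b).
Proof.
move=> [f1 f2] [g1 g2]; split; rewrite ?Re_add ?Im_add ?Re_mul ?Im_mul.
  under eq_fun do rewrite Re_mul.
  apply: is_derive_eq; rewrite /GRing.scale/=; ring.
under eq_fun do rewrite Im_mul.
apply: is_derive_eq; rewrite /GRing.scale/=; ring.
Qed.

Lemma cderive_local (f g : R -> C) (a b x : R) l : a < x < b ->
  (forall y, a <= y <= b -> f y = g y) -> cderive f x l -> cderive g x l.
Proof.
move=> axb fg [f1 f2]; split.
- by apply: (is_derive_local (f := fun s => Re (f s)) axb) => // y /fg ->.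
- by apply: (is_derive_local (f := fun s => Im (f s)) axb) => // y /fg ->.
Qed.

Lemma cderive_affine (f : R -> C) (x al be : R) l : cderive f (al * x + be) l ->
  cderive (fun s => f (al * s + be)) x (toC al * l).
Proof.
have aff : is_derive x (1 : R) (fun s : R => al * s + be : R^o) al.
  by apply: is_derive_eq; rewrite /GRing.scale/= ?mulr1 ?mulr0 ?addr0 ?add0r.
move=> [f1 f2]; split; rewrite ?Re_mul ?Im_mul/= mul0r ?subr0 ?addr0.
  have := @is_derive1_comp _ (fun s => Re (f s) : R^o) (fun s : R => al * s + be : R^o) x _ _ f1 aff.
  by rewrite mulrC.
have := @is_derive1_comp _ (fun s => Im (f s) : R^o) (fun s : R => al * s + be : R^o) x _ _ f2 aff.
by rewrite mulrC.
Qed.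

Variable T : R.

Definition lip (f : R -> C) := exists2 K : R, 0 <= K &
  forall x y, 0 <= x <= y -> y <= T -> nrm (f y - f x) <= K * (y - x).

Lemma lipschitzP (f : R -> R) :
  [lipschitz (f x : R^o) | x in (`[0, T]%classic : set R^o)] <->
  exists2 K : R, 0 <= K &
    forall x y, 0 <= x <= y -> y <= T -> `|f y - f x| <= K * (y - x).
Proof.
split.
  move=> [M [Mr HM]].
  exists (`|M| + 1); first by rewrite addr_ge0.
  move=> x y /andP[x0 xy] yT.
  have M1 : M < `|M| + 1 by rewrite (le_lt_trans (ler_norm _))// ltrDl.
  have := HM _ M1 (y, x); rewrite /= [`|y - x|]ger0_norm ?subr_ge0//; apply.
  by rewrite !in_itv/= x0 yT (le_trans x0 xy) (le_trans xy yT).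
move=> [K K0 HK].
exists K; split; first exact: num_real.
move=> M KM [x y]/= []; rewrite !in_itv/= => /andP[x0 xT] /andP[y0 yT].
have [xy|yx] := leP x y.
  rewrite distrC [`|x - y|]distrC (le_trans (HK _ _ _ _))// ?x0//.
  by rewrite [`|y - x|]ger0_norm ?subr_ge0// ler_wpM2r ?subr_ge0// ltW.
rewrite (le_trans (HK _ _ _ _))// ?y0 ?(ltW yx)//.
by rewrite [`|x - y|]ger0_norm ?subr_ge0 ?(ltW yx)// ler_wpM2r ?subr_ge0 ?ltW.
Qed.

Lemma clipschitzP (f : R -> C) : clipschitz `[0, T] f <-> lip f.
Proof.
rewrite /clipschitz !lipschitzP; split.
  move=> [[K1 K10 H1] [K2 K20 H2]]; exists (K1 + K2); first exact: addr_ge0.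
  move=> x y xy yT; rewrite (le_trans (nrm_le _))// mulrDl.
  by rewrite Re_add Im_add Re_opp Im_opp lerD ?H1 ?H2.
move=> [K K0 H]; split; exists K => // x y xy yT; apply: le_trans (H _ _ xy yT).
  by rewrite -Re_opp -Re_add nrm_Re.
by rewrite -Im_opp -Im_add nrm_Im.
Qed.

Lemma lip_bounded f : lip f -> exists2 K, 0 <= K & forall x, 0 <= x <= T -> nrm (f x) <= K.
Proof.
move=> [K K0 H]; exists (nrm (f 0) + K * `|T|) => [|x /andP[x0 xT]].
  by rewrite addr_ge0 ?nrm_ge0 ?mulr_ge0.
rewrite -[f x](subrK (f 0)) addrC (le_trans (nrmD _ _))// lerD2l.
by rewrite (le_trans (H _ _ _ _)) ?lexx ?x0// subr0 ler_wpM2l// (le_trans xT)// ler_norm.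
Qed.

Lemma lip_ext f g : (forall x, 0 <= x <= T -> f x = g x) -> lip f -> lip g.
Proof.
move=> fg [K K0 H]; exists K => // x y /andP[x0 xy] yT.
by rewrite -!fg ?H ?x0 ?yT ?(le_trans xy) ?(le_trans x0).
Qed.

Lemma lipM f g : lip f -> lip g -> lip (fun x => f x * g x).
Proof.
move=> lf lg; have [Bf Bf0 Hf] := lip_bounded lf; have [Bg Bg0 Hg] := lip_bounded lg.
move: lf lg => [Kf Kf0 Lf] [Kg Kg0 Lg].
exists (Bf * Kg + Bg * Kf); first by rewrite addr_ge0 ?mulr_ge0.
move=> x y /andP[x0 xy] yT.
have -> : f y * g y - f x * g x = f y * (g y - g x) + g x * (f y - f x) by ring.
rewrite (le_trans (nrmD _ _))// !nrmM mulrDl -!mulrA.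
by rewrite lerD// ler_pM ?nrm_ge0 ?Hf ?Hg ?Lf ?Lg ?x0 ?yT ?(le_trans xy) ?(le_trans x0).
Qed.

Lemma lipD f g : lip f -> lip g -> lip (fun x => f x + g x).
Proof.
move=> [Kf Kf0 Lf] [Kg Kg0 Lg]; exists (Kf + Kg); first by rewrite addr_ge0.
move=> x y xy yT.
have -> : f y + g y - (f x + g x) = (f y - f x) + (g y - g x) by ring.
by rewrite (le_trans (nrmD _ _))// mulrDl lerD ?Lf ?Lg.
Qed.

Lemma lip_cst c : lip (fun=> c).
Proof. by exists 0 => // x y _ _; rewrite subrr nrm0 mul0r. Qed.

(** The common form of every differential equation below. Being Lipschitz is what makes the almost
    everywhere derivative determine [f] up to a constant. *)
Definition prim (f g : R -> C) :=
  lip f /\ {ae mu, forall x, 0 <= x <= T -> cderive f x (g x)}.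

Lemma prim_lip f g : prim f g -> lip f. Proof. by case. Qed.

Lemma ae_interior (P : R -> Prop) :
  {ae mu, forall x, 0 < x < T -> P x} -> {ae mu, forall x, 0 <= x <= T -> P x}.
Proof.
move=> aP.
have a1 (c : R) : {ae mu, forall x, x <> c}.
  exists [set c]; split => //; first by rewrite lebesgue_measure_set1.
  by move=> x /contrapT.
have := ae_conj aP (ae_conj (a1 0) (a1 T)); apply: ae_weaken => x [H [/eqP x0 /eqP xT]] /andP[hx0 hxT].
by apply: H; rewrite !lt_neqAle eq_sym x0 hx0 xT.
Qed.

Lemma prim_ext f f' g g' : prim f g -> (forall x, 0 <= x <= T -> f x = f' x) ->
  {ae mu, forall x, 0 <= x <= T -> g x = g' x} -> prim f' g'.
Proof.
move=> [lf df] ff' gg'; split; first exact: lip_ext lf.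
apply: ae_interior; have := ae_conj df gg'; apply: ae_weaken => x [H1 H2] /andP[x0 xT].
have x0T : 0 <= x <= T by rewrite !ltW.
by rewrite -H2//; apply: (@cderive_local f _ 0 T) => //; [rewrite x0|exact: H1].
Qed.

Lemma prim_cst c : prim (fun=> c) (fun=> 0).
Proof. by split; [exact: lip_cst|apply: aeW => x _; exact: cderive_cst]. Qed.

Lemma primD f g f' g' : prim f f' -> prim g g' ->
  prim (fun x => f x + g x) (fun x => f' x + g' x).
Proof.
move=> [lf df] [lg dg]; split; first exact: lipD.
by have := ae_conj df dg; apply: ae_weaken => x [H1 H2] xT; apply: cderiveD; auto.
Qed.

Lemma primM f g f' g' : prim f f' -> prim g g' ->
  prim (fun x => f x * g x) (fun x => f' x * g x + f x * g' x).
Proof.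
move=> [lf df] [lg dg]; split; first exact: lipM.
by have := ae_conj df dg; apply: ae_weaken => x [H1 H2] xT; apply: cderiveM; auto.
Qed.

Lemma primZ c f f' : prim f f' -> prim (fun x => c * f x) (fun x => c * f' x).
Proof.
move=> pf; apply: (prim_ext (primM (prim_cst c) pf)) => //.
by apply: aeW => x _; rewrite mul0r add0r.
Qed.

Lemma primB f g f' g' : prim f f' -> prim g g' ->
  prim (fun x => f x - g x) (fun x => f' x - g' x).
Proof.
move=> pf pg; apply: (prim_ext (primD pf (primZ (-1) pg))).
  by move=> x _; rewrite mulN1r.
by apply: aeW => x _; rewrite mulN1r.
Qed.

Lemma primX f f' n : prim f f' ->
  prim (fun x => f x ^+ n.+1) (fun x => n.+1%:R * f x ^+ n * f' x).
Proof.
move=> pf; elim: n => [|n IH].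
  by apply: (prim_ext pf); [move=> x _; rewrite expr1|apply: aeW => x _; rewrite expr0 !mul1r].
apply: (prim_ext (primM pf IH)); first by move=> x _; rewrite -exprS.
apply: aeW => x _; rewrite -[n.+2]add1n natrD !exprS; ring.
Qed.

Lemma prim_sum (I : Type) (r : seq I) (F G : I -> R -> C) :
  (forall i, prim (F i) (G i)) ->
  prim (fun x => \sum_(i <- r) F i x) (fun x => \sum_(i <- r) G i x).
Proof.
move=> FG; elim: r => [|i r IH].
  apply: (prim_ext (prim_cst 0)); first by move=> x _; rewrite big_nil.
  by apply: aeW => x _; rewrite big_nil.
apply: (prim_ext (primD (FG i) IH)); first by move=> x _; rewrite big_cons.
by apply: aeW => x _; rewrite big_cons.
Qed.

Lemma prim_id : prim (fun x => toC x) (fun=> 1).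
Proof.
split.
  exists 1 => // x y /andP[x0 xy] yT.
  by rewrite -toCN -toCD nrm_toC ger0_norm ?subr_ge0// mul1r.
apply: aeW => x _; split => /=; first exact: is_derive_id.
exact: is_derive_cst.
Qed.

(** After a rotation [u], the increment of [f] is the increment of Re (u f), and phi - Re (u f) has
    a nonnegative derivative almost everywhere. A linear [phi] gives the mean value inequality; a
    power [phi] gives the majorant for the return map. *)
Lemma prim_growth f g (phi dphi : R -> R) x y : prim f g ->
  prim (fun x => toC (phi x)) (fun x => toC (dphi x)) ->
  {ae mu, forall s, x <= s <= y -> nrm (g s) <= dphi s} ->
  0 <= x <= y -> y <= T -> nrm (f y - f x) <= phi y - phi x.
Proof.
move=> pf pphi gphi /andP[x0 xy] yT.
have [u u1 uE] := nrm_rotate (f y - f x).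
have [[K K0 lK] dh] := primB pphi (primZ u pf).
pose h s := Re (toC (phi s) - u * f s).
have : h x <= h y.
  apply: (@ae_derive_ge0_le _ _ K) => //.
    move=> s t /andP[xs st] ty; apply: le_trans (lK s t _ _).
    - by rewrite /h -Re_opp -Re_add nrm_Re.
    - by rewrite (le_trans x0 xs).
    - exact: le_trans ty yT.
  have := ae_conj dh gphi; apply: ae_weaken => s [H1 H2] /andP[xs sy].
  have sT : 0 <= s <= T by rewrite (le_trans x0 xs) (le_trans sy yT).
  exists (Re (toC (dphi s) - u * g s)); last by have [] := H1 sT.
  rewrite Re_add Re_opp/= subr_ge0 (le_trans _ (H2 _)) ?xs//.
  by rewrite (le_trans (ler_norm _))// (le_trans (nrm_Re _))// nrmM u1 mul1r.
rewrite /h !Re_add !Re_opp/= => H.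
have -> : nrm (f y - f x) = Re (u * f y) - Re (u * f x).
  by rewrite -Re_opp -Re_add -mulrBr uE.
lra.
Qed.

Lemma prim_bound_on f g c x y : prim f g ->
  {ae mu, forall s, x <= s <= y -> nrm (g s) <= c} ->
  0 <= x <= y -> y <= T -> nrm (f y - f x) <= c * (y - x).
Proof.
move=> pf gc xy yT.
rewrite mulrBr; apply: (prim_growth (phi := fun x => c * x) (dphi := fun=> c) pf) => //.
apply: (prim_ext (primZ (toC c) prim_id)); first by move=> s _; rewrite toCM.
by apply: aeW => s _; rewrite mulr1.
Qed.

Lemma prim_bound f g c x y : prim f g ->
  {ae mu, forall x, 0 <= x <= T -> nrm (g x) <= c} ->
  0 <= x <= y -> y <= T -> nrm (f y - f x) <= c * (y - x).
Proof.
move=> pf gc /andP[x0 xy] yT; apply: (prim_bound_on pf) => //; last by rewrite x0.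
apply: ae_weaken gc => s H /andP[xs sy]; apply: H.
by rewrite (le_trans x0 xs) (le_trans sy yT).
Qed.

Lemma prim_unique f g f' : prim f f' -> prim g f' -> f 0 = g 0 ->
  forall x, 0 <= x <= T -> f x = g x.
Proof.
move=> pf pg fg0 x /andP[x0 xT]; apply/eqP; rewrite -subr_eq0; apply/eqP/nrm_eq0/le_anti.
rewrite nrm_ge0 andbT.
have := prim_bound (c := 0) (x := 0) (y := x) (primB pf pg).
rewrite fg0 subrr subr0 mul0r; apply => //; last by rewrite lexx.
by apply: aeW => s _; rewrite subrr nrm0.
Qed.

Definition cmeas (h : R -> C) :=
  measurable_fun `[0, T] (fun x => Re (h x)) /\ measurable_fun `[0, T] (fun x => Im (h x)).

Lemma prim_integral h K : cmeas h ->
  {ae mu, forall x, 0 <= x <= T -> nrm (h x) <= K} ->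
  prim (fun x => cintegral `[0, x] h) h.
Proof.
move=> [mr mi] hK.
have kr : {ae mu, forall x, `[0, T]%classic x -> `|Re (h x)| <= K}.
  by apply: ae_weaken hK => x H; rewrite /= in_itv/= => /H; apply: le_trans (nrm_Re _).
have ki : {ae mu, forall x, `[0, T]%classic x -> `|Im (h x)| <= K}.
  by apply: ae_weaken hK => x H; rewrite /= in_itv/= => /H; apply: le_trans (nrm_Im _).
split.
  exists (`|K| + `|K|); first by rewrite addr_ge0.
  move=> x y xy yT; rewrite (le_trans (nrm_le _))// mulrDl Re_add Im_add Re_opp Im_opp/=.
  by rewrite lerD//; [exact: (antideriv_lipschitz mr kr)|exact: (antideriv_lipschitz mi ki)].
apply: ae_interior.
have := ae_conj (antideriv_ae_derive mr kr) (antideriv_ae_derive mi ki).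
by apply: ae_weaken => x [H1 H2] xT; split; [exact: H1|exact: H2].
Qed.

Lemma prim_integral_rev h K : cmeas h ->
  {ae mu, forall x, 0 <= x <= T -> nrm (h x) <= K} ->
  prim (fun x => cintegral `[x, T] h) (fun x => - h x).
Proof.
move=> mh hK; have [mr mi] := mh.
have kr : {ae mu, forall x, `[0, T]%classic x -> `|Re (h x)| <= K}.
  by apply: ae_weaken hK => x H; rewrite /= in_itv/= => /H; apply: le_trans (nrm_Re _).
have ki : {ae mu, forall x, `[0, T]%classic x -> `|Im (h x)| <= K}.
  by apply: ae_weaken hK => x H; rewrite /= in_itv/= => /H; apply: le_trans (nrm_Im _).
have key (f : R -> R) x : measurable_fun `[0, T] f ->
    {ae mu, forall x, `[0, T]%classic x -> `|f x| <= K} -> 0 <= x <= T ->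
    \int[mu]_(t in `[0, T]) f t - \int[mu]_(t in `[0, x]) f t = \int[mu]_(t in `[x, T]) f t.
  move=> mf fK /andP[x0 xT].
  rewrite Rintegral_itvB//; last exact: (itv_integrable mf fK).
  rewrite Rintegral_itv_obnd_cbnd//; apply: (itv_integrable mf fK) => z /=.
  by rewrite !in_itv/= => /andP[xz ->]; rewrite (le_trans x0) ?ltW.
apply: (prim_ext (primB (prim_cst (cintegral `[0, T] h)) (prim_integral mh hK))).
  by move=> x xT; apply: cplx_eq; rewrite ?Re_add ?Im_add ?Re_opp ?Im_opp/= key.
by apply: aeW => x _; rewrite sub0r.
Qed.

End Primitive.

(** * Affine changes of time and measurability *)

Section Affine.
Variable R : realType.
Notation mu := (@lebesgue_measure R).

Lemma measurable_affine (al be : R) (D : set R) : measurable_fun D (fun x : R => al * x + be).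
Proof. by apply: measurable_funD => //; exact: measurable_funM. Qed.

(** The pushforward of Lebesgue measure under the affine map, multiplied by |al|, gives each
    half-open interval its length, hence is Lebesgue measure by uniqueness. *)
Lemma affine_preimage_null (al be : R) (N : set R) : al != 0 -> measurable N ->
  mu N = 0%E -> mu ((fun x => al * x + be) @^-1` N) = 0%E.
Proof.
move=> al0 mN N0.
pose phi (x : measurableTypeR R) : measurableTypeR R := al * x + be.
have mphi : measurable_fun setT phi by exact: measurable_affine.
pose pf : {measure set (measurableTypeR R) -> \bar R} :=
  measure_function_pushforward__canonical__measure_function_Measure mu mphi.
have al1 : 0 <= `|al| by [].
pose nu : {measure set (measurableTypeR R) -> \bar R} := mscale (NngNum al1) pf.
have H : mu N = nu N.
  apply: (lebesgue_measure_unique (mu := nu)) => // X [[u v] _ <-]/=.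
  rewrite /nu/= /pf /mscale /pushforward/=.
  have al0' : `|al| != 0 by rewrite normr_eq0.
  have E1 (lo hi : R) (i : interval R) : i = `]lo, hi] \/ i = `[lo, hi[ ->
      mu [set` i] = if lo < hi then (hi - lo)%:E else 0%E.
    by move=> [|] ->; rewrite lebesgue_measure_itv/= lte_fin.
  rewrite (E1 u v) ?(orbT, eqxx); last by left.
  have -> : pushforward mu phi `]u, v] =
      if u < v then ((v - u) / `|al|)%:E else 0%E.
    rewrite /pushforward.
    have [alp|aln] := ltP 0 al.
      have -> : phi @^-1` `]u, v] = `](u - be) / al, (v - be) / al]%classic.
        apply/seteqP; split => x /=; rewrite !in_itv/= /phi.
          by rewrite ltr_pdivrMr// ler_pdivlMr// ltrBlDr lerBrDr [x * al]mulrC.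
        by rewrite ltr_pdivrMr// ler_pdivlMr// ltrBlDr lerBrDr [x * al]mulrC.
      rewrite (E1 ((u - be) / al) ((v - be) / al)); last by left.
      rewrite ltr_pM2r ?invr_gt0// ltrD2r; case: ifP => // _; congr EFin.
      by rewrite gtr0_norm//; field; rewrite gt_eqF.
    have {}aln : al < 0 by rewrite lt_neqAle al0.
    have -> : phi @^-1` `]u, v] = `[(v - be) / al, (u - be) / al[%classic.
      apply/seteqP; split => x /=; rewrite !in_itv/= /phi.
        by rewrite ltr_ndivlMr// ler_ndivrMr// lerBrDr ltrBlDr [x * al]mulrC andbC.
      by rewrite ltr_ndivlMr// ler_ndivrMr// lerBrDr ltrBlDr [x * al]mulrC andbC.
    rewrite (E1 ((v - be) / al) ((u - be) / al)); last by right.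
    rewrite ltr_nM2r ?invr_lt0// ltrD2r; case: ifP => // _; congr EFin.
    by rewrite ltr0_norm//; field; rewrite lt_eqF.
  case: ifP => // _; last by rewrite mule0.
  by rewrite -EFinM mulrC mulfVK.
move: H; rewrite N0 /nu/= /pf /mscale /pushforward/= => /esym/eqP.
by rewrite mule_eq0 eqe normr_eq0 (negbTE al0)/= => /eqP.
Qed.

Lemma ae_affine (al be : R) (P : R -> Prop) : al != 0 ->
  {ae mu, forall x, P x} -> {ae mu, forall x, P (al * x + be)}.
Proof.
move=> al0 [N [mN N0 NP]]; exists ((fun x => al * x + be) @^-1` N); split.
- rewrite -[X in measurable X]setTI; exact: measurable_affine.
- exact: affine_preimage_null.
- by move=> x /= nP; exact: NP.
Qed.

Notation C := (Cplx R).
Variable T : R.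

Lemma prim_affine (f g : R -> C) (al be : R) : al != 0 ->
  (forall x, 0 <= x <= T -> 0 <= al * x + be <= T) -> prim T f g ->
  prim T (fun x => f (al * x + be)) (fun x => toC al * g (al * x + be)).
Proof.
move=> al0 alT [[K K0 lf] df]; split.
  exists (K * `|al|) => [|x y /andP[x0 xy] yT]; first by rewrite mulr_ge0.
  have /andP[ax0 axT] : 0 <= al * x + be <= T by rewrite alT// x0 (le_trans xy).
  have /andP[ay0 ayT] : 0 <= al * y + be <= T by rewrite alT// yT (le_trans x0).
  have [alp|aln] := ltP 0 al.
    rewrite (le_trans (lf _ _ _ _))//; first by rewrite ax0 lerD2r ler_pM2l.
    by rewrite gtr0_norm// -mulrA ler_wpM2l// lerBDr; lra.
  rewrite nrm_dist (le_trans (lf _ _ _ _))//; first by rewrite ay0 lerD2r ler_wnM2l.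
  by rewrite ler0_norm// -mulrA ler_wpM2l//; lra.
have := ae_affine be al0 df; apply: ae_weaken => x H xT; apply: cderive_affine.
by apply: H; exact: alT.
Qed.

Lemma lip_cmeas (f : R -> C) : lip T f -> cmeas T f.
Proof.
move=> [K K0 lf].
have key (g : R -> R) : (forall x y, 0 <= x <= y -> y <= T -> `|g y - g x| <= K * (y - x)) ->
    measurable_fun `[0, T] g.
  move=> lg; have [T0|T0] := leP 0 T; last first.
    rewrite set_itv_ge ?bnd_simp -?ltNge//; exact: measurable_fun_set0.
  (* Clamping the argument to the interval extends [g] to a continuous, hence measurable, function
     on the line. *)
  pose c (x : R) := Num.max 0 (Num.min T x).
  have c0 x : 0 <= c x by rewrite le_max lexx.
  have cT x : c x <= T by rewrite ge_max T0 ge_min lexx.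
  have cmono x y : x <= y -> c x <= c y /\ c y - c x <= y - x.
    move=> xy; rewrite /c /Num.max /Num.min.
    by do ! case: ifP; lra.
  have cg : continuous (fun x => g (c x)).
    move=> x; apply/cvgrPdist_le => e e0.
    have K1 : 0 < K + 1 by lra.
    have eK : 0 < e / (K + 1) by rewrite divr_gt0.
    near=> y.
    have : `|x - y| <= e / (K + 1).
      near: y; apply: cvgr_dist_le; [exact: cvg_id|exact: eK].
    rewrite ler_pdivlMr// => xye.
    have H : `|g (c x) - g (c y)| <= K * `|x - y|.
      have [xy|yx] := leP x y.
        have [cxy cxy'] := cmono _ _ xy.
        rewrite distrC (le_trans (lg _ _ _ _)) ?c0//.
        by rewrite distrC ger0_norm ?subr_ge0// ler_wpM2l.
      have [cxy cxy'] := cmono _ _ (ltW yx).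
      rewrite (le_trans (lg _ _ _ _)) ?c0//.
      by rewrite gtr0_norm ?subr_gt0// ler_wpM2l.
    apply: le_trans H (le_trans _ xye).
    by rewrite mulrC ler_wpM2l// lerDl.
  have : measurable_fun `[0, T] (fun x => g (c x)).
    apply: measurable_funTS; exact: continuous_measurable_fun.
  apply: eq_measurable_fun => x; rewrite inE/= in_itv/= => /andP[x0 xT].
  by rewrite /c min_r// max_r.
split; apply: key => x y xy yT; apply: le_trans (lf _ _ xy yT).
  by rewrite -Re_opp -Re_add nrm_Re.
by rewrite -Im_opp -Im_add nrm_Im.
Unshelve. all: by end_near. Qed.

Lemma cmeas_eq (f g : R -> C) : (forall x, f x = g x) -> cmeas T f -> cmeas T g.
Proof. by move=> fg; have -> : g = f by apply/funext => x; rewrite fg. Qed.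

Lemma cmeasM (f g : R -> C) : cmeas T f -> cmeas T g -> cmeas T (fun x => f x * g x).
Proof.
move=> [f1 f2] [g1 g2]; split.
  apply: (eq_measurable_fun (fun x => complex.Re (f x) * complex.Re (g x)
      - complex.Im (f x) * complex.Im (g x))) => [x _|]; first by rewrite Re_mul.
  by apply: measurable_funB; exact: measurable_funM.
apply: (eq_measurable_fun (fun x => complex.Re (f x) * complex.Im (g x)
    + complex.Im (f x) * complex.Re (g x))) => [x _|]; first by rewrite Im_mul.
by apply: measurable_funD; exact: measurable_funM.
Qed.

Lemma cmeasD (f g : R -> C) : cmeas T f -> cmeas T g -> cmeas T (fun x => f x + g x).
Proof.
move=> [f1 f2] [g1 g2]; split.
  apply: (eq_measurable_fun (fun x => complex.Re (f x) + complex.Re (g x)))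
    => [x _|]; first by rewrite Re_add.
  exact: measurable_funD.
apply: (eq_measurable_fun (fun x => complex.Im (f x) + complex.Im (g x)))
  => [x _|]; first by rewrite Im_add.
exact: measurable_funD.
Qed.

Lemma cmeas_cst c : cmeas T (fun=> c).
Proof. by split; exact: measurable_cst. Qed.

Lemma cmeas_sum (I : Type) (r : seq I) (F : I -> R -> C) :
  (forall i, cmeas T (F i)) -> cmeas T (fun x => \sum_(i <- r) F i x).
Proof.
move=> mF; elim: r => [|i r IH].
  by apply: (cmeas_eq _ (cmeas_cst 0)) => x; rewrite big_nil.
by apply: (cmeas_eq _ (cmeasD (mF i) IH)) => x; rewrite big_cons.
Qed.

Lemma cmeas_affine (f : R -> C) (al be : R) (D : set R) : measurable D -> D `<=` `[0, T] ->
  (forall x, D x -> 0 <= al * x + be <= T) -> cmeas T f ->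
  measurable_fun D (fun x => complex.Re (f (al * x + be))) /\
  measurable_fun D (fun x => complex.Im (f (al * x + be))).
Proof.
move=> mD DT aT [f1 f2]; split.
  apply: (@measurable_comp _ _ _ _ _ _ `[0, T] (fun x => complex.Re (f x)) _ (fun x => al * x + be)) => //.
    by move=> _ [x /aT xT <-]/=; rewrite in_itv.
  exact: measurable_affine.
apply: (@measurable_comp _ _ _ _ _ _ `[0, T] (fun x => complex.Im (f x)) _ (fun x => al * x + be)) => //.
  by move=> _ [x /aT xT <-]/=; rewrite in_itv.
exact: measurable_affine.
Qed.

End Affine.

(** * Paths and iterated integrals *)

Section Paths.
Variable R : realType.
Notation mu := (@lebesgue_measure R).
Notation C := (Cplx R).
Notation nrm := (@Normc.normc R).
Variable T : R.

Lemma in_itvT (x : R) : (`[0, T]%classic : set R) x = (0 <= x <= T) :> Prop.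
Proof. by rewrite /= in_itv. Qed.

Definition geom_bounded (a : coefs R) (M : R) := forall j,
  {ae mu, forall x, 0 <= x <= T -> nrm (a j x) <= M ^+ j.+1}.

Lemma X_normP (a : coefs R) : X T a <->
  (forall j, cmeas T (a j)) /\ exists2 M, 1 <= M & geom_bounded a M.
Proof.
split.
  move=> [aL [M aM]]; split; first by move=> j; have [] := aL j.
  exists (Num.max 1 M); first by rewrite le_max lexx.
  move=> j; apply: ae_weaken (aM j) => x H; rewrite -in_itvT => /H {}H.
  have nge := nrm_ge0 (a j x).
  have -> : nrm (a j x) = (nrm (a j x) `^ (j.+1%:R)^-1) ^+ j.+1.
    by rewrite -powR_mulrn ?powR_ge0// -powRrM mulVf ?pnatr_eq0// powRr1.
  by rewrite lerXn2r ?nnegrE ?powR_ge0 ?le_max ?ler01// H orbT.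
move=> [am [M M1 aM]]; split.
  move=> j; split; [exact: (am j).1|exact: (am j).2|exists (M ^+ j.+1)].
  by apply: ae_weaken (aM j) => x; rewrite in_itvT.
exists M => j; apply: ae_weaken (aM j) => x; rewrite in_itvT => H /H {}H.
have M0 : 0 <= M by lra.
have -> : M = (M ^+ j.+1) `^ (j.+1%:R)^-1.
  by rewrite -powR_mulrn// -powRrM mulfV ?pnatr_eq0// powRr1.
by rewrite ge0_ler_powR ?nnegrE ?invr_ge0 ?nrm_ge0 ?exprn_ge0.
Qed.

Lemma cintegral0 (h : R -> C) c : cintegral `[c, c] h = 0.
Proof. by apply: cplx_eq; rewrite /= set_itv1 Rintegral_set1. Qed.

(* The coefficient of the word w in the path F_a, as an iterated integral whose
   first letter is the outermost one. *)
Fixpoint pathc (a : coefs R) (w : word) (x : R) : C :=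
  if w is j :: w' then cintegral `[0, x] (fun s => a j s * pathc a w' s) else 1.

Lemma pathc0 a w : pathc a w 0 = (w == [::])%:R.
Proof. by case: w => //= j w; rewrite cintegral0. Qed.

Lemma iterated_fromT a w : iterated_from T a w T = (w == [::])%:R.
Proof. by case: w => //= j w; rewrite cintegral0. Qed.

(** The generator is supported on one-letter words, so its product with [F x] merely strips the
    first letter. The equation in the algebra is thus a triangular system, solvable and uniquely so
    by induction on the word. *)
Definition pathD (a : coefs R) (F : R -> ncseries R) (w : word) (x : R) : C :=
  if w is j :: w' then a j x * F x w' else 0.

Lemma ncmul_generator a F w x : ncmul (generator a x) (F x) w = pathD a F w x.
Proof.
case: w => [|j w]; rewrite /ncmul.
  by rewrite big_ord_recl big_ord0 /= mul0r addr0.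
rewrite big_ord_recl /= mul0r add0r big_ord_recl /= take0 drop0 big1 ?addr0// => i _.
by case: w i => [[]|j' w i] //=; rewrite mul0r.
Qed.

(** No initial value is imposed, so that reparametrised pieces of a path still qualify. *)
Definition lin_sol (a : coefs R) (F : R -> ncseries R) :=
  forall w, prim T (fun x => F x w) (pathD a F w).

Lemma path_solutionP a F : path_solution T a F <-> F 0 = ncone R /\ lin_sol a F.
Proof.
split.
  move=> [F0 Fl Fd]; split => // w; split; first exact/clipschitzP.
  by apply: ae_weaken (Fd w) => x; rewrite in_itvT ncmul_generator.
move=> [F0 Fs]; split => // w; first by apply/clipschitzP; exact: (Fs w).1.
by apply: ae_weaken (Fs w).2 => x; rewrite in_itvT ncmul_generator.
Qed.

Lemma lin_sol_unique a F G : lin_sol a F -> lin_sol a G ->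
  (forall w, F 0 w = G 0 w) -> forall w x, 0 <= x <= T -> F x w = G x w.
Proof.
move=> sF sG FG0; elim => [|j w IH] x xT.
  exact: (prim_unique (sF [::]) (sG [::])).
have pG : prim T (fun y => G y (j :: w)) (pathD a F (j :: w)).
  by apply: (prim_ext (sG (j :: w))) => //; apply: aeW => y yT /=; rewrite IH.
exact: (prim_unique (sF (j :: w)) pG).
Qed.

Lemma prim_bounded_mul (h f : R -> C) M : cmeas T h -> lip T f ->
  {ae mu, forall x, 0 <= x <= T -> nrm (h x) <= M} ->
  cmeas T (fun s => h s * f s) /\
  exists K, {ae mu, forall x, 0 <= x <= T -> nrm (h x * f x) <= K}.
Proof.
move=> mh lf hM; split; first by apply: cmeasM => //; exact: lip_cmeas.
have [K K0 fK] := lip_bounded lf; exists (M * K).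
by apply: ae_weaken hM => x H xT; rewrite nrmM ler_pM ?nrm_ge0 ?H ?fK.
Qed.

Lemma pathc_sol a : X T a -> lin_sol a (fun x w => pathc a w x).
Proof.
move=> /X_normP[am [M M1 aM]]; elim => [|j w IH] /=; first exact: prim_cst.
have [mh [K hK]] := prim_bounded_mul (am j) (prim_lip IH) (aM j).
exact: prim_integral hK.
Qed.

Definition fromD (a : coefs R) (w : word) (x : R) : C :=
  if w is j :: w' then - (a j x * iterated_from T a w' x) else 0.

Lemma iterated_from_prim a w : X T a -> prim T (iterated_from T a w) (fromD a w).
Proof.
move=> /X_normP[am [M M1 aM]]; elim: w => [|j w IH] /=; first exact: prim_cst.
have [mh [K hK]] := prim_bounded_mul (am j) (prim_lip IH) (aM j).
exact: prim_integral_rev hK.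
Qed.

Lemma path_of_sol a : X T a -> path_solution T a (path_of T a).
Proof.
move=> Xa; rewrite /path_of.
have sol : path_solution T a (fun x w => pathc a w x).
  apply/path_solutionP; split; last exact: pathc_sol.
  by apply/funext => w; rewrite pathc0.
exact: (xgetPex _ (ex_intro _ _ sol)).
Qed.

Lemma path_of_pathc a w x : X T a -> 0 <= x <= T -> path_of T a x w = pathc a w x.
Proof.
move=> Xa xT; have /path_solutionP[F0 sF] := path_of_sol Xa.
apply: (lin_sol_unique sF (pathc_sol Xa)) => // w'.
by rewrite F0 pathc0.
Qed.

Hypothesis T0 : 0 < T.

Lemma E_pathc a w : X T a -> E T a w = pathc a w T.
Proof. by move=> Xa; apply: path_of_pathc => //; rewrite lexx ltW. Qed.

(* Splitting the simplex at time x, the sum of the products of the two parts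
   does not depend on x. *)
Lemma iterated_pathc a u : X T a -> iterated T u a = pathc a (rev u) T.
Proof.
move=> Xa; pose n := size u.
pose Phi x := \sum_(m < n.+1) pathc a (rev (take m u)) x * iterated_from T a (drop m u) x.
have pPhi : prim T Phi (fun x => \sum_(m < n.+1)
    (pathD a (fun x w => pathc a w x) (rev (take m u)) x * iterated_from T a (drop m u) x
     + pathc a (rev (take m u)) x * fromD a (drop m u) x)).
  apply: prim_sum => m; apply: (primM (pathc_sol Xa _)); exact: iterated_from_prim.
have dPhi x : \sum_(m < n.+1)
    (pathD a (fun x w => pathc a w x) (rev (take m u)) x * iterated_from T a (drop m u) x
     + pathc a (rev (take m u)) x * fromD a (drop m u) x) = 0.
  rewrite big_split/= big_ord_recl /= take0/= mul0r add0r.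
  rewrite [X in _ + X]big_ord_recr/= drop_size/= mulr0 addr0 -big_split big1// => i _ /=.
  rewrite /bump/= add1n (take_nth 0%N) ?ltn_ord// rev_rcons/=.
  by rewrite (@drop_nth _ 0%N i u (ltn_ord i))/=; ring.
have H : Phi T = Phi 0.
  have pPhi0 : prim T Phi (fun=> 0).
    by apply: (prim_ext pPhi) => //; apply: aeW => x _; rewrite dPhi.
  by apply: (prim_unique pPhi0 (prim_cst T (Phi 0))) => //; rewrite lexx ltW.
move: H; rewrite /Phi big_ord_recr/= big1 ?add0r => [|i _]; last first.
  rewrite iterated_fromT; case: eqP => [|_]; last by rewrite mulr0.
  by move/(congr1 size); rewrite size_drop/= => /eqP; rewrite subn_eq0 leqNgt ltn_ord.
rewrite take_size drop_size /= mulr1 => ->.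
rewrite big_ord_recl/= big1 ?addr0 => [|i _]; last first.
  rewrite pathc0; case: eqP => [|_]; last by rewrite mul0r.
  move/(congr1 size); rewrite size_rev size_take /bump/=.
  case: ifP => // _ n0; have : (i < 0)%N by rewrite -n0; exact: ltn_ord.
  by [].
by rewrite take0 drop0/= mul1r.
Qed.

(** Each letter contributes one integration over a length of at most [T] with an integrand factor of
    at most [eta]. Applied to the correcting path, this puts its endpoint near the unit in low
    weight. *)
Lemma pathc_small a w eta N : X T a -> 0 <= eta -> (forall j, j \in w -> (j < N)%N) ->
  (forall j, (j < N)%N -> {ae mu, forall x, 0 <= x <= T -> nrm (a j x) <= eta}) ->
  forall x, 0 <= x <= T -> nrm (pathc a w x) <= (eta * T) ^+ size w.
Proof.
move=> Xa eta0 + aeta; elim: w => [|j w IH] wN x /andP[x0 xT].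
  by rewrite expr0 (nrm1 R : nrm (pathc a [::] x) = 1).
have {}IH y : 0 <= y <= T -> nrm (pathc a w y) <= (eta * T) ^+ size w.
  by apply: IH => i iw; apply: wN; rewrite inE iw orbT.
have jN : (j < N)%N by apply: wN; rewrite mem_head.
have ET0 : 0 <= (eta * T) ^+ size w by rewrite exprn_ge0// mulr_ge0// ltW.
have := prim_bound (c := eta * (eta * T) ^+ size w) (x := 0) (y := x) (pathc_sol Xa (j :: w)).
rewrite pathc0 subr0 subr0 lexx => H.
apply: le_trans (H _ _ xT) _ => //.
  by apply: ae_weaken (aeta j jN) => y Hy yT; rewrite /= nrmM ler_pM ?nrm_ge0 ?Hy ?IH.
by rewrite [size _]/= exprS mulrAC ler_wpM2r// ler_wpM2l.
Qed.

(** The generator acts on the left, so it commutes with right multiplication by a constant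
    series. *)
Lemma lin_sol_mulr a F (h : ncseries R) : lin_sol a F ->
  lin_sol a (fun x => ncmul (F x) h).
Proof.
move=> sF w; rewrite /ncmul.
apply: (prim_ext (prim_sum (index_enum 'I_(size w).+1) (fun k : 'I_(size w).+1 =>
  primM (sF (take k w)) (prim_cst T (h (drop k w)))))) => //.
apply: aeW => x _; case: w => [|j w] /=.
  by rewrite big_ord_recl big_ord0 /= mul0r mulr0 !addr0.
rewrite big_ord_recl/= mul0r mulr0 addr0 add0r big_distrr/=.
by apply: eq_bigr => i _; rewrite mulr0 addr0 mulrA.
Qed.

Lemma ncmul1r (f : ncseries R) : ncmul (ncone R) f = f.
Proof.
apply/funext => w; rewrite /ncmul big_ord_recl/= take0 drop0 mul1r.
by case: w => [|j w]; rewrite big1 ?addr0// => i _; [case: i|rewrite mul0r].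
Qed.

End Paths.

(** * Solutions with small initial value *)

Section ComplexLimits.
Variable R : realType.
Notation C := (Cplx R).
Notation nrm := (@Normc.normc R).

Lemma cplx_normE (z : C) : `|z| = toC (nrm z). Proof. by []. Qed.

Lemma cplx_cvgP (u : nat -> C) (l : C) : (u @ \oo --> l) <->
  forall e : R, 0 < e -> exists N, forall n, (N <= n)%N -> nrm (l - u n) < e.
Proof.
split.
  move=> /cvgrPdist_lt ul e e0.
  have e0' : 0 < toC e :> C by rewrite ltcE/= eqxx e0.
  have [N _ NP] := ul _ e0'; exists N => n Nn.
  by have := NP n Nn; rewrite /= cplx_normE ltcE/= => /andP[].
move=> H; apply/cvgrPdist_lt => e; rewrite ltcE/= => /andP[/eqP ie re].
have [N NP] := H _ re; exists N => // n /NP Hn.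
by rewrite /= cplx_normE ltcE/= ie eqxx.
Qed.

Lemma geom_sum2 (q : R) n : 0 <= q -> q <= 2^-1 -> \sum_(j < n) q ^+ j <= 2.
Proof.
move=> q0 q2; suff : \sum_(j < n) q ^+ j <= 2 - 2 * q ^+ n.
  by have : 0 <= q ^+ n by [exact: exprn_ge0]; lra.
elim: n => [|n IH]; first by rewrite big_ord0 expr0; lra.
rewrite big_ord_recr/= exprS.
have : 0 <= q ^+ n by exact: exprn_ge0.
nra.
Qed.

Lemma series_tail (u : nat -> C) (l : C) (A q : R) N : 0 <= A -> 0 <= q -> q <= 2^-1 ->
  (forall j, nrm (u j) <= A * q ^+ j) -> (series u @ \oo --> l) ->
  nrm (l - \sum_(j < N) u j) <= 2 * A * q ^+ N.
Proof.
move=> A0 q0 q2 uA /cplx_cvgP ul; apply/ler_addgt0Pr => e e0.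
have [N' HN'] := ul e e0.
have {HN'} := HN' (N + N')%N (leq_addl _ _).
rewrite /series/= big_mkord => Hl.
set s := \sum_(j < N + N') u j in Hl *.
have -> : l - \sum_(j < N) u j = (l - s) + (s - \sum_(j < N) u j) by ring.
rewrite (le_trans (nrmD _ _))// addrC lerD ?(ltW Hl)//.
rewrite /s big_split_ord/= [X in X - _]addrC addrK.
rewrite (le_trans (nrm_sum _ _ _))//.
rewrite (@le_trans _ _ (\sum_(i < N') A * q ^+ N * q ^+ i))//.
  by apply: ler_sum => i _; rewrite -mulrA -exprD uA.
rewrite -big_distrr/= -[leRHS]mulrA [leRHS]mulrC ler_wpM2l ?geom_sum2//.
by rewrite mulr_ge0 ?exprn_ge0.
Qed.

Lemma nrm_powB (w z : C) (rho : R) n : nrm w <= rho -> nrm z <= rho ->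
  nrm (w ^+ n.+1 - z ^+ n.+1) <= n.+1%:R * rho ^+ n * nrm (w - z).
Proof.
move=> wr zr; have r0 : 0 <= rho by rewrite (le_trans (nrm_ge0 w)).
rewrite subrXX nrmM mulrC ler_wpM2r ?nrm_ge0//.
rewrite (le_trans (nrm_sum _ _ _))//.
rewrite (@le_trans _ _ (\sum_(i < n.+1) rho ^+ n))//.
  apply: ler_sum => i _; rewrite nrmM !nrmX.
  have -> : rho ^+ n = rho ^+ (n.+1 - 1 - i) * rho ^+ i.
    by rewrite -exprD subn1/= subnK// -ltnS.
  rewrite subn1/= ler_pM ?exprn_ge0 ?nrm_ge0//; last by rewrite lerXn2r ?nnegrE ?nrm_ge0.
  by rewrite lerXn2r ?nnegrE ?nrm_ge0.
by rewrite sumr_const card_ord mulr_natl.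
Qed.

Lemma half_pow_small (c e : R) : 0 < e -> exists k, c * 2^-1 ^+ k < e.
Proof.
move=> e0; have c1 : 0 < `|c| + 1 by rewrite ltr_wpDl.
have : (fun k => (2^-1 : R) ^+ k) @ \oo --> (0 : R).
  by apply: cvg_expr; rewrite ger0_norm ?invr_ge0// invf_lt1 ?ltr1n.
move=> /cvgrPdist_lt /(_ (e / (`|c| + 1))); rewrite divr_gt0// => /(_ isT)[k _ kP].
exists k; have := kP k (leqnn k); rewrite /= sub0r normrN ger0_norm ?exprn_ge0 ?invr_ge0//.
rewrite ltr_pdivlMr// => H; apply: le_lt_trans H.
by rewrite mulrC ler_wpM2l ?exprn_ge0 ?invr_ge0// (le_trans (ler_norm _))// lerDl.
Qed.

(** Completeness is used on real and imaginary parts separately; each is within [2 * c * 2^-1 ^+ k]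
    of its limit, whence the constant 4. *)
Lemma geom_cauchy (u : nat -> C) (c : R) : 0 <= c ->
  (forall k, nrm (u k.+1 - u k) <= c * 2^-1 ^+ k) ->
  exists l, forall k, nrm (l - u k) <= 4 * c * 2^-1 ^+ k.
Proof.
move=> c0 uc.
have step k n : nrm (u (k + n)%N - u k) <= 2 * c * 2^-1 ^+ k - 2 * c * 2^-1 ^+ (k + n).
  elim: n => [|n IH]; first by rewrite addn0 !subrr nrm0.
  have -> : u (k + n.+1)%N - u k = (u (k + n).+1 - u (k + n)%N) + (u (k + n)%N - u k).
    by rewrite addnS; ring.
  rewrite (le_trans (nrmD _ _))// (le_trans (lerD (uc _) IH))// addnS exprS.
  by lra.
have {}step k n : nrm (u (k + n)%N - u k) <= 2 * c * 2^-1 ^+ k.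
  have : 0 <= 2 * c * 2^-1 ^+ (k + n).
    by rewrite mulr_ge0 ?exprn_ge0 ?invr_ge0// mulr_ge0.
  by have := step k n; lra.
have key (p : C -> R) : (forall z w, p (z - w) = p z - p w) -> (forall z, `|p z| <= nrm z) ->
    exists l, forall k, `|l - p (u k)| <= 2 * c * 2^-1 ^+ k.
  move=> pB pn.
  have ck : cvgn (fun k => p (u k)).
    apply/cauchy_cvgP/cauchyP => e e0.
    have [k ke] := half_pow_small (2 * c) e0.
    exists (p (u k)), k => // n /= kn; rewrite /ball/= distrC -pB.
    by rewrite (le_lt_trans (pn _))// (le_lt_trans _ ke)// -(subnKC kn).
  exists (limn (fun k => p (u k))) => k.
  apply/ler_addgt0Pr => e e0.
  move/cvgrPdist_lt : ck => /(_ e e0)[N _ HN].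
  have := HN (N + k)%N (leq_addr _ _); set l := lim _ => /= Hl.
  have -> : l - p (u k) = (l - p (u (N + k)%N)) + (p (u (N + k)%N) - p (u k)) by ring.
  rewrite (le_trans (ler_normD _ _))// addrC lerD ?(ltW Hl)//.
  by rewrite -pB (le_trans (pn _))// addnC.
have [lr Hr] := key (@complex.Re R) (fun z w => etrans (Re_add _ _) (congr1 _ (Re_opp w))) (@nrm_Re R).
have [li Hi] := key (@complex.Im R) (fun z w => etrans (Im_add _ _) (congr1 _ (Im_opp w))) (@nrm_Im R).
exists (lr +i* li)%C => k; rewrite (le_trans (nrm_le _))// Re_add Im_add Re_opp Im_opp/=.
have := Hr k; have := Hi k; lra.
Qed.
End ComplexLimits.

(** * A priori bounds and the transport estimate *)

Section SmallSolutions.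
Variable R : realType.
Notation mu := (@lebesgue_measure R).
Notation C := (Cplx R).
Notation nrm := (@Normc.normc R).
Variable T : R.
Hypothesis T0 : 0 < T.

Lemma ode_solutionP (a : coefs R) v : ode_solution T a v <->
  exists2 g, prim T v g & {ae mu, forall x, 0 <= x <= T ->
    series (fun j => a j x * v x ^+ j.+2) @ \oo --> (g x : C)}.
Proof.
split; last first.
  move=> [g [lv dv] sg]; split; first exact/clipschitzP.
  by apply: ae_weaken (ae_conj dv sg) => x [Hd Hs]; rewrite in_itvT => xT; exists (g x); split; auto.
move=> [/clipschitzP lv dv].
pose P x : set C := [set l | (series (fun j => a j x * v x ^+ j.+2) @ \oo --> l) /\ cderive v x l].
exists (fun x => get (P x)).
  split=> //; apply: ae_weaken dv => x; rewrite in_itvT => H /H Hl.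
  exact: (@getPex _ (P x) Hl).2.
apply: ae_weaken dv => x; rewrite in_itvT => H /H Hl.
exact: (@getPex _ (P x) Hl).1.
Qed.

Lemma field_term (al z : C) (M rho : R) j : 0 <= M -> nrm al <= M ^+ j.+1 -> nrm z <= rho ->
  nrm (al * z ^+ j.+2) <= M * rho ^+ 2 * (M * rho) ^+ j.
Proof.
move=> M0 aM zr; have r0 : 0 <= rho by rewrite (le_trans (nrm_ge0 z)).
rewrite nrmM nrmX.
have -> : M * rho ^+ 2 * (M * rho) ^+ j = M ^+ j.+1 * rho ^+ j.+2.
  by rewrite exprMn -[j.+2]addn2 exprD [M ^+ j.+1]exprS; ring.
by rewrite ler_pM ?exprn_ge0 ?nrm_ge0// lerXn2r ?nnegrE ?nrm_ge0.
Qed.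

Lemma field_tail (al : nat -> C) (z l : C) (M rho : R) N : 0 <= M -> 2 * (M * rho) <= 1 ->
  (forall j, nrm (al j) <= M ^+ j.+1) -> nrm z <= rho ->
  (series (fun j => al j * z ^+ j.+2) @ \oo --> l) ->
  nrm (l - \sum_(j < N) al j * z ^+ j.+2) <= 2 * (M * rho ^+ 2) * (M * rho) ^+ N.
Proof.
move=> M0 Mr aM zr sl; have r0 : 0 <= rho by rewrite (le_trans (nrm_ge0 z)).
apply: (series_tail (u := fun j => al j * z ^+ j.+2)) => //.
- by rewrite mulr_ge0 ?exprn_ge0.
- by rewrite mulr_ge0.
- by rewrite -[leRHS]mul1r ler_pdivlMr// mulrC.
- by move=> j; exact: field_term.
Qed.

(** Continuation: while |v| <= 2 rho the field is at most [K] = 8 M rho^2, so [v] moves by at most K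
    T, which is strictly less than rho. The strictness leaves room to go on. The convergence of the
    field along [v] is part of the hypothesis on [v], but gives no bound by itself. *)
Lemma ode_small (a : coefs R) v (M rho : R) : 0 <= M -> geom_bounded T a M ->
  ode_solution T a v -> 0 < rho -> nrm (v 0) <= rho ->
  4 * (M * rho) <= 1 -> 8 * (M * rho) * T < 1 ->
  forall x, 0 <= x <= T -> nrm (v x) <= 2 * rho.
Proof.
move=> M0 aM /ode_solutionP[g pv sg] rho0 v0 Mr MrT.
pose K := 8 * (M * rho ^+ 2).
have KT : K * T < rho.
  have -> : K * T = 8 * (M * rho) * T * rho by rewrite /K; ring.
  by rewrite -[ltRHS]mul1r ltr_pM2r.
have K0 : 0 <= K by apply: mulr_ge0 => //; apply: mulr_ge0 => //; apply: exprn_ge0; exact: ltW.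
have bound (x : R) : 0 <= x <= T -> nrm (v x - v 0) <= K * x -> nrm (v x) <= rho + K * T.
  move=> /andP[x0 xT] H; rewrite -[v x](subrK (v 0)) addrC (le_trans (nrmD _ _))// lerD//.
  by rewrite (le_trans H)// ler_wpM2l.
have [Kv Kv0 lv] := prim_lip pv.
suff H x : 0 <= x <= T -> nrm (v x - v 0) <= K * x.
  by move=> x xT; have := bound x xT (H x xT); lra.
have /ae_foralln aM' := aM.
apply: (@real_induction R 0 T (fun x => nrm (v x - v 0) <= K * x)).
- by rewrite subrr nrm0 mulr0.
- move=> {}x /andP[x0 xT] Hx.
  have Hx' : nrm (v x) <= rho + K * T by apply: bound => //; rewrite x0 ltW.
  (* Over a time [d] the Lipschitz constant [Kv] of [v] can use up only the remaining gap
     [rho - K * T]. *)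
  pose d := (rho - K * T) / (Kv + 1).
  have Kv1 : 0 < Kv + 1 by lra.
  have d0 : 0 < d by rewrite divr_gt0// subr_gt0.
  exists (Num.min d (T - x)); first by rewrite lt_min d0 subr_gt0.
  move=> y; rewrite -ltrBlDl lt_min => /and3P[xy yd yT'].
  have yT : y <= T by lra.
  have small s : x <= s <= y -> nrm (v s) <= 2 * rho.
    move=> /andP[xs sy]; rewrite -[v s](subrK (v x)) addrC (le_trans (nrmD _ _))//.
    have H1 : nrm (v s - v x) <= Kv * (s - x).
      by apply: lv; rewrite ?x0// (le_trans sy).
    have H2 : Kv * (s - x) <= rho - K * T.
      have : (Kv + 1) * (s - x) <= (Kv + 1) * d by rewrite ler_wpM2l ?ltW//; lra.
      rewrite /d mulrCA mulfV ?gt_eqF// mulr1; nra.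
    lra.
  have H : nrm (v y - v x) <= K * (y - x).
    apply: (prim_bound_on pv); rewrite ?x0 ?(ltW xy)//.
    apply: ae_weaken (ae_conj sg aM') => s [Hs Ha] xsy.
    have sT : 0 <= s <= T by apply/andP; split; case/andP: xsy => *; lra.
    have := @field_tail (fun j => a j s) (v s) (g s) M (2 * rho) 0 M0.
    rewrite big_ord0 subr0 expr0 mulr1 => Hf.
    have -> : K = 2 * (M * (2 * rho) ^+ 2) by rewrite /K; ring.
    by apply: Hf; [lra|move=> j; exact: Ha|exact: small|exact: Hs].
  cbv beta; rewrite -[v y](subrK (v x)) -addrA (le_trans (nrmD _ _))//; lra.
- move=> {}x /andP[x0 xT] Hy.
  apply/ler_addgt0Pr => e e0.
  pose y := Num.max 0 (x - e / (Kv + 1)).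
  have Kv1 : 0 < Kv + 1 by lra.
  have d0 : 0 < e / (Kv + 1) by rewrite divr_gt0.
  have y0 : 0 <= y by rewrite le_max lexx.
  have yx : y < x by rewrite gt_max x0 ltrBlDr ltrDl.
  have xy : x - y <= e / (Kv + 1) by rewrite lerBlDr -lerBlDl le_max lexx orbT.
  have H1 : nrm (v x - v y) <= Kv * (x - y) by apply: lv => //; rewrite y0 ltW.
  have H2 : Kv * (x - y) <= e.
    have : (Kv + 1) * (x - y) <= e by rewrite mulrC -ler_pdivlMr.
    nra.
  have := Hy y; rewrite y0 yx => /(_ isT) H3.
  have H4 : K * y <= K * x by rewrite ler_wpM2l// ltW.
  cbv beta; rewrite -[v x](subrK (v y)) -addrA (le_trans (nrmD _ _))//; lra.
Qed.

(** The coefficient of r^(n+1) in F_x + (sum_j a_j r^(j+2)) F_r = 0 for F = sum_n S_n r^(n+1): the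
    factor [n - j] comes from differentiating r^(n-j). *)
Definition transport_system (a : coefs R) (S : nat -> R -> C) := forall n,
  prim T (S n) (fun x => - \sum_(j < n) a j x * (n - j)%:R * S (n - j.+1)%N x).

(** Reindexing by n = m + j + 1: the degree-m term of F meets the j-th term of the field in the
    transport equation of index n. *)
Lemma antidiagonal_sum (V : nmodType) (f : nat -> nat -> V) N :
  \sum_(m < N.+1) \sum_(j < N - m) f m j = \sum_(n < N.+1) \sum_(j < n) f (n - j.+1)%N j.
Proof.
elim: N => [|N IH].
  by rewrite !big_ord_recl !big_ord0.
rewrite [RHS]big_ord_recr/= -IH big_ord_recr/= subnn big_ord0 addr0.
rewrite [X in _ = _ + X](reindex_inj rev_ord_inj)/= -big_split/=.
apply: eq_bigr => m _; rewrite subSS subSn ?leq_ord// big_ord_recr/=.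
by congr (_ + f _ _); rewrite subKn// leq_ord.
Qed.

Lemma sum_pow2 n : \sum_(m < n) (2 : R) ^+ m <= 2 ^+ n.
Proof.
elim: n => [|n IH]; first by rewrite big_ord0 expr0 ler01.
rewrite big_ord_recr/= exprS mulr_natl mulr2n lerD2r//.
Qed.

Lemma natr_le_pow2 m : (m.+1%:R : R) <= 2 ^+ m.
Proof. by rewrite -natrX ler_nat; exact: ltn_expl. Qed.

(* sum_n S_n(x) v(x)^(n+1) is formally constant along a solution v, the
   transport equation for S being dual to the differential equation for v. *)
Lemma transport (a : coefs R) S v (L rho : R) N : 0 <= L -> geom_bounded T a L ->
  transport_system a S -> (forall n x, 0 <= x <= T -> nrm (S n x) <= L ^+ n) ->
  ode_solution T a v -> (forall x, 0 <= x <= T -> nrm (v x) <= rho) -> 2 * (L * rho) <= 1 ->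
  nrm (\sum_(n < N.+1) S n T * v T ^+ n.+1 - \sum_(n < N.+1) S n 0 * v 0 ^+ n.+1)
    <= 2 * rho * (2 * (L * rho)) ^+ N.+1 * T.
Proof.
move=> L0 aL sS SL /ode_solutionP[g pv sg] vr Lr.
have rho0 : 0 <= rho by rewrite (le_trans (nrm_ge0 (v 0)))// vr// lexx ltW.
pose G x := \sum_(n < N.+1) S n x * v x ^+ n.+1.
have pG : prim T G (fun x => \sum_(n < N.+1)
    (- (\sum_(j < n) a j x * (n - j)%:R * S (n - j.+1)%N x) * v x ^+ n.+1
     + S n x * (n.+1%:R * v x ^+ n * g x))).
  by apply: prim_sum => n; apply: primM (sS n) (primX n pv).
have := prim_bound (c := 2 * rho * (2 * (L * rho)) ^+ N.+1) (x := 0) (y := T) pG.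
rewrite subr0 lexx ltW//; apply => //.
have /ae_foralln aL' := aL.
apply: ae_weaken (ae_conj sg aL') => x [Hs Ha] xT.
(* The transport equations up to index [N] cancel exactly the field terms [j < N - m] against [S m];
   only the tail [e m] survives. *)
pose e m : C := g x - \sum_(j < N - m) a j x * v x ^+ j.+2.
have -> : \sum_(n < N.+1)
    (- (\sum_(j < n) a j x * (n - j)%:R * S (n - j.+1)%N x) * v x ^+ n.+1
     + S n x * (n.+1%:R * v x ^+ n * g x)) =
    \sum_(m < N.+1) S m x * (m.+1%:R * v x ^+ m) * e m.
  pose f m j := S m x * (m.+1%:R * v x ^+ m) * (a j x * v x ^+ j.+2).
  have E1 : \sum_(m < N.+1) S m x * (m.+1%:R * v x ^+ m) * e m =
      \sum_(m < N.+1) S m x * (m.+1%:R * v x ^+ m * g x) - \sum_(m < N.+1) \sum_(j < N - m) f m j.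
    rewrite -sumrB; apply: eq_bigr => m _; rewrite /e mulrBr; congr (_ - _); first by rewrite !mulrA.
    by rewrite big_distrr/=.
  have E2 : \sum_(n < N.+1) - (\sum_(j < n) a j x * (n - j)%:R * S (n - j.+1)%N x) * v x ^+ n.+1
      = - \sum_(n < N.+1) \sum_(j < n) f (n - j.+1)%N j.
    rewrite -sumrN; apply: eq_bigr => n _; rewrite mulNr big_distrl/=; congr (- _).
    apply: eq_bigr => j _; rewrite /f -subSn// subSS.
    have -> : n.+1 = ((n - j.+1) + j.+2)%N :> nat by rewrite addnS subnK.
    by rewrite exprD; ring.
  by rewrite E1 big_split/= E2 antidiagonal_sum addrC.
rewrite (le_trans (nrm_sum _ _ _))//.
(* The weight [2 ^+ m] absorbs the factor m + 1 left by differentiating v^(m+1). *)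
rewrite (@le_trans _ _ (\sum_(m < N.+1) 2 ^+ m * (2 * (L * rho ^+ 2) * (L * rho) ^+ N)))//.
  apply: ler_sum => m _; rewrite !nrmM nrm_nat nrmX.
  have em : nrm (e m) <= 2 * (L * rho ^+ 2) * (L * rho) ^+ (N - m).
    by apply: (@field_tail (fun j => a j x)) => //; [move=> j; exact: Ha|exact: vr|exact: Hs].
  have Sm : nrm (S m x) * (m.+1%:R * nrm (v x) ^+ m) <= L ^+ m * (2 ^+ m * rho ^+ m).
    rewrite ler_pM ?SL ?nrm_ge0 ?mulr_ge0 ?exprn_ge0 ?nrm_ge0//.
    by rewrite ler_pM ?natr_le_pow2 ?exprn_ge0 ?nrm_ge0// lerXn2r ?nnegrE ?nrm_ge0 ?vr.
  have -> : 2 ^+ m * (2 * (L * rho ^+ 2) * (L * rho) ^+ N) =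
      L ^+ m * (2 ^+ m * rho ^+ m) * (2 * (L * rho ^+ 2) * (L * rho) ^+ (N - m)).
    have -> : (L * rho) ^+ N = (L * rho) ^+ (N - m) * (L ^+ m * rho ^+ m).
      by rewrite -exprMn -exprD subnK// leq_ord.
    by ring.
  by rewrite ler_pM ?mulr_ge0 ?exprn_ge0 ?nrm_ge0.
rewrite -big_distrl/=.
have -> : 2 * rho * (2 * (L * rho)) ^+ N.+1 = 2 ^+ N.+1 * (2 * (L * rho ^+ 2) * (L * rho) ^+ N).
  by rewrite exprMn [(L * rho) ^+ N.+1]exprS; ring.
by rewrite ler_wpM2r ?sum_pow2// !mulr_ge0 ?exprn_ge0// mulr_ge0.
Qed.

End SmallSolutions.

(** * Existence of solutions with small initial value *)

Section Picard.
Variable R : realType.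
Notation mu := (@lebesgue_measure R).
Notation C := (Cplx R).
Notation nrm := (@Normc.normc R).
Variable T : R.
Hypothesis T0 : 0 < T.

Lemma cmeas_cvg (h : nat -> R -> C) (f : R -> C) : (forall k, cmeas T (h k)) ->
  (forall x, 0 <= x <= T -> (h ^~ x) @ \oo --> f x) -> cmeas T f.
Proof.
move=> mh hf.
have key (p : C -> R) : (forall z w, `|p z - p w| <= nrm (z - w)) ->
    forall x, `[0, T]%classic x -> (fun k => p (h k x)) @ \oo --> p (f x).
  move=> pl x; rewrite in_itvT => xT; apply/cvgrPdist_lt => e e0.
  have /cplx_cvgP /(_ e e0)[N HN] := hf x xT.
  by exists N => // k /= /HN Hk; rewrite (le_lt_trans (pl _ _)).
split.
  apply: (@measurable_fun_cvg _ _ _ _ (fun k x => complex.Re (h k x))) => [k|].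
    exact: (mh k).1.
  by apply: (key (@complex.Re R)) => z w; rewrite -Re_opp -Re_add nrm_Re.
apply: (@measurable_fun_cvg _ _ _ _ (fun k x => complex.Im (h k x))) => [k|].
  exact: (mh k).2.
by apply: (key (@complex.Im R)) => z w; rewrite -Im_opp -Im_add nrm_Im.
Qed.

(** Picard iteration is run with bounds valid at every point. Real and imaginary parts are clipped
    separately, which costs the factor 2. *)
Lemma bounded_representative (f : R -> C) B : cmeas T f -> 0 <= B ->
  {ae mu, forall x, 0 <= x <= T -> nrm (f x) <= B} ->
  exists f', [/\ cmeas T f', forall x, nrm (f' x) <= 2 * B &
    {ae mu, forall x, 0 <= x <= T -> f x = f' x}].
Proof.
move=> [m1 m2] B0 fB.
pose clip (y : R) := Num.max (- B) (Num.min B y).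
have clipB y : `|clip y| <= B.
  by rewrite ler_norml /clip le_max lexx/= ge_max ge_min lexx andbT; lra.
have clip_id y : `|y| <= B -> clip y = y.
  by rewrite ler_norml /clip => /andP[H1 H2]; rewrite min_r// max_r.
have mclip (p : R -> R) : measurable_fun `[0, T] p -> measurable_fun `[0, T] (fun x => clip (p x)).
  move=> mp; apply: measurable_maxr; first exact: measurable_cst.
  by apply: measurable_minr; first exact: measurable_cst.
exists (fun x => (clip (complex.Re (f x)) +i* clip (complex.Im (f x)))%C); split.
- by split; exact: mclip.
- by move=> x; rewrite (le_trans (nrm_le _))//= mulr_natl mulr2n lerD.
- apply: ae_weaken fB => x H /H {}H; apply: cplx_eq; rewrite /= clip_id//.
    exact: le_trans (nrm_Re _) H.
  exact: le_trans (nrm_Im _) H.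
Qed.

Section BoundedField.
Variables (a : coefs R) (K rho : R) (r0 : C).
Hypotheses (am : forall j, cmeas T (a j)) (K0 : 0 <= K).
Hypothesis aK : forall j x, nrm (a j x) <= K ^+ j.+1.
Hypotheses (rho0 : 0 < rho) (r0rho : 2 * nrm r0 <= rho).
Hypotheses (Krho : 4 * (K * rho) <= 1) (KrhoT : 16 * (K * rho) * T <= 1).

Definition partial_field k (v : R -> C) x : C := \sum_(j < k) a j x * v x ^+ j.+2.

(** Step k + 1 integrates the field truncated to k terms, so each integrand is a finite measurable
    sum. Truncation and iteration errors both shrink like 2^-k. *)
Fixpoint picard k : R -> C :=
  if k is k'.+1 then fun x => r0 + cintegral `[0, x] (partial_field k' (picard k'))
  else fun=> r0.

Let Kr0 : 0 <= K * rho. Proof. by rewrite mulr_ge0// ltW. Qed.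

Lemma partial_field_bound k v x : nrm (v x) <= rho -> nrm (partial_field k v x) <= 2 * (K * rho ^+ 2).
Proof.
move=> vr; rewrite /partial_field (le_trans (nrm_sum _ _ _))//.
rewrite (@le_trans _ _ (\sum_(j < k) K * rho ^+ 2 * (K * rho) ^+ j))//.
  by apply: ler_sum => j _; apply: field_term.
rewrite -big_distrr/= [leRHS]mulrC ler_wpM2l ?mulr_ge0 ?exprn_ge0 ?(ltW rho0)//.
by apply: geom_sum2 => //; have := Krho; lra.
Qed.

Lemma partial_field_lip k v w x : nrm (v x) <= rho -> nrm (w x) <= rho ->
  nrm (partial_field k v x - partial_field k w x) <= 4 * (K * rho) * nrm (v x - w x).
Proof.
move=> vr wr; rewrite /partial_field -sumrB (le_trans (nrm_sum _ _ _))//.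
rewrite (@le_trans _ _ (\sum_(j < k) 2 * (K * rho) * nrm (v x - w x) * (2 * (K * rho)) ^+ j))//.
  apply: ler_sum => j _; rewrite -mulrBr nrmM.
  have H1 := nrm_powB j.+1 vr wr.
  have -> : 2 * (K * rho) * nrm (v x - w x) * (2 * (K * rho)) ^+ j =
      K ^+ j.+1 * ((2 ^+ j.+1 * rho ^+ j.+1) * nrm (v x - w x)).
    by rewrite !exprMn !exprS; ring.
  rewrite ler_pM ?nrm_ge0// (le_trans H1)// ler_wpM2r ?nrm_ge0//.
  by rewrite ler_wpM2r ?exprn_ge0 ?(ltW rho0)// natr_le_pow2.
rewrite -big_distrr/=.
have -> : 4 * (K * rho) * nrm (v x - w x) = 2 * (K * rho) * nrm (v x - w x) * 2 by ring.
rewrite ler_wpM2l ?mulr_ge0 ?nrm_ge0 ?(ltW rho0)//.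
by apply: geom_sum2; have := Krho; have := Kr0; lra.
Qed.

Lemma partial_field_meas k v : lip T v -> cmeas T (partial_field k v).
Proof.
move=> lv; apply: (@cmeas_sum _ _ _ _ (fun (j : 'I_k) x => a j x * v x ^+ j.+2)) => j.
apply: cmeasM => //; apply: lip_cmeas.
elim: (j.+2 : nat) => [|n IH].
  by apply: (lip_ext _ (lip_cst T 1)) => x _; rewrite expr0.
by apply: (lip_ext _ (lipM lv IH)) => x _; rewrite exprS.
Qed.

Lemma picard_step k : lip T (picard k) -> (forall x, 0 <= x <= T -> nrm (picard k x) <= rho) ->
  prim T (picard k.+1) (partial_field k (picard k)).
Proof.
move=> lk bk.
have pI : prim T (fun x => cintegral `[0, x] (partial_field k (picard k))) (partial_field k (picard k)).
  apply: (@prim_integral _ _ _ (2 * (K * rho ^+ 2))); first exact: partial_field_meas.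
  by apply: aeW => x xT; apply: partial_field_bound; exact: bk.
apply: (prim_ext (primD (prim_cst T r0) pI)) => //.
by apply: aeW => x _; rewrite add0r.
Qed.

Lemma picard_at0 k : picard k 0 = r0.
Proof. by case: k => //= k; rewrite cintegral0 addr0. Qed.

Lemma picard_bound k : lip T (picard k) /\ (forall x, 0 <= x <= T -> nrm (picard k x) <= rho).
Proof.
elim: k => [|k [lk bk]].
  split; first exact: lip_cst.
  by move=> x _; have := nrm_ge0 r0; have := r0rho; rewrite -[picard 0 x]/r0; lra.
have pk := picard_step lk bk; split; first exact: prim_lip pk.
move=> x /andP[x0 xT].
have := prim_bound (c := 2 * (K * rho ^+ 2)) (x := 0) (y := x) pk.
rewrite picard_at0 lexx x0 subr0 => H.
have {H} : nrm (picard k.+1 x - r0) <= 2 * (K * rho ^+ 2) * x.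
  by apply: H => //; apply: aeW => y yT; apply: partial_field_bound; exact: bk.
have : 2 * (K * rho ^+ 2) * x <= rho / 2.
  rewrite (@le_trans _ _ (2 * (K * rho ^+ 2) * T))//.
    by rewrite ler_wpM2l// mulr_ge0// mulr_ge0// exprn_ge0// ltW.
  have -> : 2 * (K * rho ^+ 2) * T = (16 * (K * rho) * T) * (rho / 8) by field.
  by rewrite (@le_trans _ _ (1 * (rho / 8)))//; [rewrite ler_wpM2r ?divr_ge0 ?(ltW rho0)|have := rho0; lra].
have -> : picard k.+1 x = (picard k.+1 x - r0) + r0 by rewrite subrK.
move=> H1 H2; rewrite (le_trans (nrmD _ _))//; rewrite addrK in H2; have := r0rho; have := nrm_ge0 r0; lra.
Qed.

Lemma partial_field_succ k v x : nrm (v x) <= rho ->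
  nrm (partial_field k.+1 v x - partial_field k v x) <= rho / 4 * 2^-1 ^+ k.
Proof.
move=> vr; rewrite /partial_field big_ord_recr/= addrAC subrr add0r.
rewrite (le_trans (field_term K0 (aK _ _) vr))//.
have -> : K * rho ^+ 2 * (K * rho) ^+ k = rho * (K * rho) * (K * rho) ^+ k by ring.
rewrite ler_pM ?exprn_ge0 ?mulr_ge0 ?(ltW rho0)//.
  by rewrite ler_wpM2l ?(ltW rho0)//; have := Krho; lra.
by rewrite lerXn2r ?nnegrE//; have := Krho; lra.
Qed.

(** The new field term contributes rho / 4 * 2^-k; the Lipschitz constant 4 K rho times the previous
    difference contributes at most as much, because 16 K rho T <= 1. Integrating their sum over [T]
    halves the bound. *)
Lemma picard_diff k x : 0 <= x <= T ->
  nrm (picard k.+1 x - picard k x) <= T * rho * 2^-1 ^+ k.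
Proof.
elim: k x => [|k IH] x xT.
  (* [picard 1] integrates the field truncated to no term at all. *)
  have -> : picard 1 x = picard 0 x.
    rewrite /= (_ : cintegral _ _ = 0) ?addr0//; apply: cplx_eq => /=.
      by under eq_Rintegral do rewrite /partial_field big_ord0 /=; rewrite Rintegral_cst// mul0r.
    by under eq_Rintegral do rewrite /partial_field big_ord0 /=; rewrite Rintegral_cst// mul0r.
  by rewrite subrr nrm0 mulr_ge0 ?exprn_ge0 ?invr_ge0// mulr_ge0 ?ltW.
have [l1 b1] := picard_bound k; have [l2 b2] := picard_bound k.+1.
have := prim_bound (c := rho / 2 * 2^-1 ^+ k) (x := 0) (y := x)
  (primB (picard_step l2 b2) (picard_step l1 b1)).
rewrite !picard_at0 subrr !subr0; move: xT => /andP[x0 xT]; rewrite lexx x0 => H.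
apply: le_trans (H _ _ xT) _ => //.
  apply: aeW => y yT.
  have -> : partial_field k.+1 (picard k.+1) y - partial_field k (picard k) y =
    (partial_field k.+1 (picard k.+1) y - partial_field k (picard k.+1) y)
    + (partial_field k (picard k.+1) y - partial_field k (picard k) y) by ring.
  rewrite (le_trans (nrmD _ _))//
    (le_trans (lerD (partial_field_succ _ (b2 _ yT)) (partial_field_lip _ (b2 _ yT) (b1 _ yT))))//.
  have := ler_wpM2l (mulr_ge0 (ler0n R 4) Kr0) (IH y yT).
  have : 4 * (K * rho) * (T * rho * 2^-1 ^+ k) = 16 * (K * rho) * T * (rho / 4 * 2^-1 ^+ k) by field.
  have : 16 * (K * rho) * T * (rho / 4 * 2^-1 ^+ k) <= 1 * (rho / 4 * 2^-1 ^+ k).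
    by rewrite ler_wpM2r// mulr_ge0 ?exprn_ge0 ?invr_ge0// divr_ge0 ?ltW.
  lra.
rewrite exprS.
have -> : T * rho * (2^-1 * 2^-1 ^+ k) = rho / 2 * 2^-1 ^+ k * T by field.
by rewrite ler_wpM2l// mulr_ge0 ?exprn_ge0 ?invr_ge0// divr_ge0 ?ltW.
Qed.

(** The limit is taken of the fields along the iterates, not of the iterates: integrating that limit
    [H] yields a Lipschitz [v] with derivative [H] almost everywhere. The bounds in 2^-k then
    identify [H] with the full field along [v]. *)
Lemma picard_limit : exists v, ode_solution T a v /\ v 0 = r0.
Proof.
pose h k := partial_field k (picard k).
have bk k := (picard_bound k).2.
have hdiff k x : 0 <= x <= T -> nrm (h k.+1 x - h k x) <= rho * 2^-1 ^+ k.
  move=> xT.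
  have -> : h k.+1 x - h k x = (partial_field k.+1 (picard k.+1) x - partial_field k (picard k.+1) x)
    + (partial_field k (picard k.+1) x - partial_field k (picard k) x) by rewrite /h; ring.
  rewrite (le_trans (nrmD _ _))//
    (le_trans (lerD (partial_field_succ _ (bk _ _ xT)) (partial_field_lip _ (bk _ _ xT) (bk _ _ xT))))//.
  have := ler_wpM2l (mulr_ge0 (ler0n R 4) Kr0) (picard_diff k xT).
  have : 4 * (K * rho) * (T * rho * 2^-1 ^+ k) = 16 * (K * rho) * T * (rho / 4 * 2^-1 ^+ k) by field.
  have : 0 <= rho * 2^-1 ^+ k by rewrite mulr_ge0 ?exprn_ge0 ?invr_ge0// ltW.
  have : 16 * (K * rho) * T * (rho / 4 * 2^-1 ^+ k) <= 1 * (rho / 4 * 2^-1 ^+ k).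
    by rewrite ler_wpM2r// mulr_ge0 ?exprn_ge0 ?invr_ge0// divr_ge0 ?ltW.
  lra.
have hlim x : exists l, 0 <= x <= T -> forall k, nrm (l - h k x) <= 4 * rho * 2^-1 ^+ k.
  have [xT|_] := boolP (0 <= x <= T); last by exists 0.
  by have [l Hl] := geom_cauchy (u := h ^~ x) (ltW rho0) (fun k => hdiff k x xT); exists l.
have [H HH] := choice hlim.
have mH : cmeas T H.
  apply: (cmeas_cvg (h := h)) => [k|x xT].
    by apply: partial_field_meas; exact: (picard_bound k).1.
  apply/cplx_cvgP => e e0; have [k ke] := half_pow_small (4 * rho) e0.
  exists k => n kn; rewrite (le_lt_trans _ ke)//.
  rewrite (le_trans (HH _ xT _))// ler_wpM2l ?mulr_ge0 ?(ltW rho0)//.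
  by rewrite ler_wiXn2l ?invr_ge0// invf_le1// ler1n.
have bH x : 0 <= x <= T -> nrm (H x) <= 2 * (K * rho ^+ 2) + 4 * rho.
  move=> xT; have := HH _ xT 0%N; rewrite expr0 mulr1 => H1.
  rewrite -[H x](subrK (h 0%N x)) addrC (le_trans (nrmD _ _))// lerD//.
  by apply: partial_field_bound; exact: bk.
pose v x := r0 + cintegral `[0, x] H.
have pv : prim T v H.
  have pI : prim T (fun x => cintegral `[0, x] H) H.
    by apply: prim_integral mH _; apply: aeW => x xT; exact: bH.
  apply: (prim_ext (primD (prim_cst T r0) pI)) => //.
  by apply: aeW => x _; rewrite add0r.
have v0 : v 0 = r0 by rewrite /v cintegral0 addr0.
have vk k x : 0 <= x <= T -> nrm (v x - picard k x) <= 5 * T * rho * 2^-1 ^+ k.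
  move=> xT; have [lk bk'] := picard_bound k.
  have := prim_bound (c := 4 * rho * 2^-1 ^+ k) (x := 0) (y := x) (primB pv (picard_step lk bk')).
  rewrite v0 picard_at0 subrr !subr0; move: (xT) => /andP[x0 xT']; rewrite lexx x0 => Hb.
  have {Hb} Hb : nrm (v x - picard k.+1 x) <= 4 * rho * 2^-1 ^+ k * x.
    by apply: Hb => //; apply: aeW => y yT; exact: HH.
  have -> : v x - picard k x = (v x - picard k.+1 x) + (picard k.+1 x - picard k x) by ring.
  rewrite (le_trans (nrmD _ _))//.
  have := picard_diff k xT.
  have : 4 * rho * 2^-1 ^+ k * x <= 4 * rho * 2^-1 ^+ k * T.
    by rewrite ler_wpM2l// mulr_ge0 ?exprn_ge0 ?invr_ge0// mulr_ge0 ?ltW.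
  lra.
have vb x : 0 <= x <= T -> nrm (v x) <= rho.
  move=> xT; apply/ler_addgt0Pr => e e0; have [k ke] := half_pow_small (5 * T * rho) e0.
  rewrite -[v x](subrK (picard k x)) addrC (le_trans (nrmD _ _))// lerD ?bk//.
  by rewrite (le_trans (vk k x xT))// ltW.
exists v; split=> //; apply/ode_solutionP; exists H => //.
apply: aeW => x xT; apply/cplx_cvgP => e e0.
have [k ke] := half_pow_small (5 * T * rho + 4 * rho) e0.
exists k => n kn; rewrite nrm_dist.
have -> : series (fun j => a j x * v x ^+ j.+2) n = partial_field n v x by rewrite /series/= big_mkord.
have -> : partial_field n v x - H x = (partial_field n v x - h n x) - (H x - h n x) by ring.
have H1 : nrm (partial_field n v x - h n x) <= 5 * T * rho * 2^-1 ^+ n.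
  rewrite (le_trans (partial_field_lip _ (vb _ xT) (bk _ _ xT)))//.
  have := vk n x xT; have := nrm_ge0 (v x - picard n x); have := Krho; have := Kr0; nra.
have H2 := HH _ xT n.
have H3 : (2^-1 : R) ^+ n <= 2^-1 ^+ k by rewrite ler_wiXn2l ?invr_ge0// invf_le1// ler1n.
rewrite (le_lt_trans (nrmB _ _))// (le_lt_trans (lerD H1 H2))//.
rewrite -mulrDl (le_lt_trans _ ke)// ler_wpM2l//.
by rewrite addr_ge0 ?mulr_ge0// ltW.
Qed.

End BoundedField.

(** Passing to clipped representatives replaces [M] by [2 * M], since 2 M^(j+1) <= (2 M)^(j+1); this
    doubles the constants of the smallness conditions. *)
Lemma ode_exists (a : coefs R) (M rho : R) (r0 : C) : (forall j, cmeas T (a j)) -> 1 <= M ->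
  geom_bounded T a M -> 0 < rho -> 2 * nrm r0 <= rho -> 8 * (M * rho) <= 1 ->
  32 * (M * rho) * T <= 1 -> exists v, ode_solution T a v /\ v 0 = r0.
Proof.
move=> am M1 aM rho0 r0r Mr MrT.
have M0 : 0 <= M by lra.
have rep j := bounded_representative (am j) (exprn_ge0 j.+1 M0) (aM j).
have [a' Ha'] := choice rep.
have a'K j x : nrm (a' j x) <= (2 * M) ^+ j.+1.
  have [_ /(_ x) H _] := Ha' j; rewrite (le_trans H)// exprMn ler_wpM2r ?exprn_ge0//.
  by rewrite exprS -{1}[2]mulr1 ler_wpM2l// exprn_ege1// ler1n.
have a'm j : cmeas T (a' j) by have [] := Ha' j.
have K0 : 0 <= 2 * M by lra.
have Kr : 4 * (2 * M * rho) <= 1 by lra.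
have KrT : 16 * (2 * M * rho) * T <= 1 by lra.
have [v [/ode_solutionP[g pv sg] v0]] := picard_limit a'm K0 a'K rho0 r0r Kr KrT.
exists v; split=> //; apply/ode_solutionP; exists g => //.
have aa' j : {ae mu, forall x, 0 <= x <= T -> a j x = a' j x} by have [] := Ha' j.
have /ae_foralln aa := aa'.
apply: ae_weaken (ae_conj sg aa) => x [Hs Ha] xT.
have -> : (fun j => a j x * v x ^+ j.+2) = (fun j => a' j x * v x ^+ j.+2).
  by apply/funext => j; rewrite Ha.
exact: Hs.
Qed.

End Picard.

(** * Concatenation and reversal of paths *)

Section Reparam.
Variable R : realType.
Notation mu := (@lebesgue_measure R).
Notation C := (Cplx R).
Variable T : R.
Hypothesis T0 : 0 < T.

(** [a] runs first, then [b], both at double speed. The arguments keep the shape [al * x + be] of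
    the affine lemmas. *)
Definition path_cat (a b : coefs R) : coefs R := fun j x =>
  if x < T / 2 then 2%:R * a j (2 * x + 0) else 2%:R * b j (2 * x + - T).

Definition path_inv (a : coefs R) : coefs R := fun j x => - a j (-1 * x + T).

Lemma path_invK a : path_inv (path_inv a) = a.
Proof.
apply/funext => j; apply/funext => x; rewrite /path_inv opprK; congr (a j _); ring.
Qed.

Lemma geom_boundedW (a : coefs R) M M' : 0 <= M -> M <= M' ->
  geom_bounded T a M -> geom_bounded T a M'.
Proof.
move=> M0 MM' aM j; apply: ae_weaken (aM j) => x H /H {}H.
by rewrite (le_trans H)// lerXn2r// nnegrE (le_trans M0).
Qed.

Lemma X_cat a b : X T a -> X T b -> X T (path_cat a b).
Proof.
move=> /X_normP[am [M M1 aM]] /X_normP[bm [M' M'1 bM]]; apply/X_normP; split.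
  move=> j.
  have split_itv : `[0, T]%classic = `[0, T / 2[%classic `|` `[T / 2, T]%classic :> set R.
    apply/seteqP; split => x /=; rewrite !in_itv/=.
      by move=> /andP[x0 xT]; have [xT2|xT2] := ltP x (T / 2); [left|right]; rewrite ?x0.
    by case=> /andP[H1 H2]; apply/andP; split; lra.
  have ma := @cmeas_affine R T (a j) 2 0 `[0, T / 2[ (measurable_itv _).
  have mb := @cmeas_affine R T (b j) 2 (- T) `[T / 2, T] (measurable_itv _).
  have [ma1 ma2] : measurable_fun `[0, T / 2[ (fun x => complex.Re (a j (2 * x + 0))) /\
      measurable_fun `[0, T / 2[ (fun x => complex.Im (a j (2 * x + 0))).
    apply: ma (am j) => [x|x]; rewrite /= !in_itv/= => /andP[H1 H2]; apply/andP; split; lra.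
  have [mb1 mb2] : measurable_fun `[T / 2, T] (fun x => complex.Re (b j (2 * x + - T))) /\
      measurable_fun `[T / 2, T] (fun x => complex.Im (b j (2 * x + - T))).
    apply: mb (bm j) => [x|x]; rewrite /= !in_itv/= => /andP[H1 H2]; apply/andP; split; lra.
  have Re2 (z : C) : complex.Re (2%:R * z) = 2 * complex.Re z.
    by rewrite -toC_nat Re_mul /= mul0r subr0.
  have Im2 (z : C) : complex.Im (2%:R * z) = 2 * complex.Im z.
    by rewrite -toC_nat Im_mul /= mul0r addr0.
  have m2 (D : set R) (f : R -> R) : measurable_fun D f -> measurable_fun D (fun x => 2 * f x).
    by move=> mf; apply: measurable_funM.
  split; rewrite split_itv; apply/measurable_funU => //; split.
  - apply: (eq_measurable_fun (fun x : R => 2 * complex.Re (a j (2 * x + 0)))); last exact: m2.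
    by move=> x; rewrite inE/= in_itv/= /path_cat => /andP[_ ->]; rewrite Re2.
  - apply: (eq_measurable_fun (fun x : R => 2 * complex.Re (b j (2 * x + - T)))); last exact: m2.
    by move=> x; rewrite inE/= in_itv/= /path_cat ltNge => /andP[-> _]; rewrite Re2.
  - apply: (eq_measurable_fun (fun x : R => 2 * complex.Im (a j (2 * x + 0)))); last exact: m2.
    by move=> x; rewrite inE/= in_itv/= /path_cat => /andP[_ ->]; rewrite Im2.
  - apply: (eq_measurable_fun (fun x : R => 2 * complex.Im (b j (2 * x + - T)))); last exact: m2.
    by move=> x; rewrite inE/= in_itv/= /path_cat ltNge => /andP[-> _]; rewrite Im2.
pose L := Num.max M M'.
have L1 : 1 <= L by rewrite le_max M1.
have aL : geom_bounded T a L by apply: geom_boundedW aM; [lra|rewrite le_max lexx].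
have bL : geom_bounded T b L by apply: geom_boundedW bM; [lra|rewrite le_max lexx orbT].
exists (2 * L); first lra.
move=> j; have L0 : 0 <= L ^+ j.+1 by rewrite exprn_ge0//; lra.
have n2 : (2 : R) != 0 by rewrite pnatr_eq0.
have := ae_conj (ae_affine 0 n2 (aL j)) (ae_affine (- T) n2 (bL j)).
apply: ae_weaken => x [Ha Hb] /andP[x0 xT].
have le2 : 2 * L ^+ j.+1 <= (2 * L) ^+ j.+1.
  by rewrite exprMn ler_wpM2r// exprS -{1}[2]mulr1 ler_wpM2l// exprn_ege1// ler1n.
apply: le_trans le2; rewrite /path_cat.
case: ltP => xT2; rewrite nrmM nrm_nat ler_wpM2l//; [apply: Ha|apply: Hb]; lra.
Qed.

Lemma X_inv a : X T a -> X T (path_inv a).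
Proof.
move=> /X_normP[am [M M1 aM]]; apply/X_normP; split.
  move=> j; have [m1 m2] : measurable_fun `[0, T] (fun x => complex.Re (a j (-1 * x + T))) /\
      measurable_fun `[0, T] (fun x => complex.Im (a j (-1 * x + T))).
    apply: cmeas_affine (am j) => //.
    by move=> x; rewrite /= !in_itv/= => /andP[H1 H2]; apply/andP; split; lra.
  apply: (cmeas_eq (f := fun x => -1 * a j (-1 * x + T))).
    by move=> x; rewrite mulN1r.
  by apply: cmeasM; [exact: cmeas_cst|split].
exists M => // j; have := ae_affine T (_ : -1 != 0) (aM j).
rewrite oppr_eq0 oner_eq0 => /(_ isT); apply: ae_weaken => x H /andP[x0 xT].
by rewrite /path_inv nrmN; apply: H; apply/andP; split; lra.
Qed.

Lemma lin_sol_affine (a c : coefs R) F (al be : R) : al != 0 ->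
  (forall x, 0 <= x <= T -> 0 <= al * x + be <= T) ->
  (forall j, {ae mu, forall x, 0 <= x <= T -> toC al * c j (al * x + be) = a j x}) ->
  lin_sol T c F -> lin_sol T a (fun x => F (al * x + be)).
Proof.
move=> al0 alT ca sF w; apply: (prim_ext (prim_affine al0 alT (sF w))) => //.
case: w => [|j w] /=; first by apply: aeW => x _; rewrite mulr0.
by apply: ae_weaken (ca j) => x H /H <-; rewrite mulrA.
Qed.

(** At x = T the rescaled argument already lies in the second half; this point is discarded as
    null. *)
Lemma cat_left a b : forall j, {ae mu, forall x, 0 <= x <= T ->
  toC 2^-1 * path_cat a b j (2^-1 * x + 0) = a j x}.
Proof.
move=> j; apply: ae_interior; apply: aeW => x /andP[x0 xT].
have xT2 : 2^-1 * x + 0 < T / 2 by rewrite addr0 mulrC ltr_pM2r.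
rewrite /path_cat xT2 mulrA toCV toC_nat mulVf ?pnatr_eq0// mul1r; congr (a j _).
by rewrite !addr0 mulrA mulfV ?mul1r// pnatr_eq0.
Qed.

Lemma cat_right a b : forall j, {ae mu, forall x, 0 <= x <= T ->
  toC 2^-1 * path_cat a b j (2^-1 * x + T / 2) = b j x}.
Proof.
move=> j; apply: aeW => x /andP[x0 xT].
have xT2 : (2^-1 * x + T / 2 < T / 2) = false.
  by apply/negbTE; rewrite -leNgt lerDr mulr_ge0.
rewrite /path_cat xT2 mulrA toCV toC_nat mulVf ?pnatr_eq0// mul1r; congr (b j _).
by field.
Qed.

Lemma inv_rev a : forall j, {ae mu, forall x, 0 <= x <= T ->
  toC (-1) * path_inv a j (-1 * x + T) = a j x}.
Proof.
move=> j; apply: aeW => x _; rewrite /path_inv toCN toC1 mulrNN mul1r.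
by congr (a j _); ring.
Qed.

Lemma half_left (x : R) : 0 <= x <= T -> 0 <= 2^-1 * x + 0 <= T.
Proof. by move=> /andP[x0 xT]; apply/andP; split; lra. Qed.

Lemma half_right (x : R) : 0 <= x <= T -> 0 <= 2^-1 * x + T / 2 <= T.
Proof. by move=> /andP[x0 xT]; apply/andP; split; lra. Qed.

Lemma reflect_itv (x : R) : 0 <= x <= T -> 0 <= -1 * x + T <= T.
Proof. by move=> /andP[x0 xT]; apply/andP; split; lra. Qed.

Let n2 : (2^-1 : R) != 0. Proof. by rewrite invr_eq0 pnatr_eq0. Qed.
Let nN1 : (-1 : R) != 0. Proof. by rewrite oppr_eq0 oner_eq0. Qed.
Let TT : 0 <= T <= T. Proof. by rewrite lexx ltW. Qed.

(** The path of [a], multiplied on the right by [F 0], solves the same equation with the same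
    initial value as [F]. *)
Lemma lin_sol_flow a F w : X T a -> lin_sol T a F -> F T w = ncmul (E T a) (F 0) w.
Proof.
move=> Xa sF; have -> : E T a = fun w => pathc a w T.
  by apply/funext => u; exact: E_pathc.
apply: (lin_sol_unique sF (lin_sol_mulr (F 0) (pathc_sol Xa))) => // u.
have e : (fun w => pathc a w 0) = ncone R by apply/funext => u'; rewrite pathc0.
by rewrite -[LHS](congr1 (fun f => f u) (ncmul1r (F 0))) -e.
Qed.

(** On the second half the concatenated path solves the equation of [b] starting from [E T a], so
    the later path is the left factor. *)
Lemma E_cat a b : X T a -> X T b -> E T (path_cat a b) = ncmul (E T b) (E T a).
Proof.
move=> Xa Xb; have Xc := X_cat Xa Xb; have sc := pathc_sol Xc.
apply/funext => w; rewrite E_pathc//.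
have H1 := lin_sol_affine n2 half_left (cat_left a b) sc.
have H2 := lin_sol_affine n2 half_right (cat_right a b) sc.
have half1 : (fun w => pathc (path_cat a b) w (2^-1 * T + 0)) = E T a.
  apply/funext => u; rewrite E_pathc//; apply: (lin_sol_unique H1 (pathc_sol Xa)) => //.
  by move=> u'; rewrite mulr0 addr0 !pathc0.
have := lin_sol_flow w Xb H2.
have -> : 2^-1 * T + T / 2 = T by field.
by move=> ->; congr (ncmul _ _ w); rewrite -half1 mulr0 add0r addr0 mulrC.
Qed.

(** Run backwards, the path of [path_inv a] solves the equation of [a] and leads from
    [E T (path_inv a)] to the unit. *)
Lemma E_inv a : X T a -> ncmul (E T a) (E T (path_inv a)) = ncone R.
Proof.
move=> Xa; have Xi := X_inv Xa.
have H := lin_sol_affine nN1 reflect_itv (inv_rev a) (pathc_sol Xi).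
apply/funext => w; have := lin_sol_flow w Xa H.
have -> : -1 * T + T = 0 by ring.
rewrite pathc0 mulr0 add0r => e; rewrite [RHS]e; congr (ncmul _ _ w).
by apply/funext => u; rewrite E_pathc.
Qed.

Lemma E_invl a : X T a -> ncmul (E T (path_inv a)) (E T a) = ncone R.
Proof. by move=> Xa; rewrite -{2}(path_invK a) E_inv//; exact: X_inv. Qed.

Lemma ode_affine (a c : coefs R) v (al be : R) : al != 0 ->
  (forall x, 0 <= x <= T -> 0 <= al * x + be <= T) ->
  (forall j, {ae mu, forall x, 0 <= x <= T -> toC al * c j (al * x + be) = a j x}) ->
  ode_solution T c v -> ode_solution T a (fun x => v (al * x + be)).
Proof.
move=> al0 alT ca /ode_solutionP[g pv sg]; apply/ode_solutionP.
exists (fun x => toC al * g (al * x + be)); first exact: prim_affine.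
have /ae_foralln ca' := ca.
have := ae_conj (ae_affine be al0 sg) ca'; apply: ae_weaken => x [Hv Ha] xT.
have -> : series (fun j => a j x * v (al * x + be) ^+ j.+2) =
    (fun n => toC al * series (fun j => c j (al * x + be) * v (al * x + be) ^+ j.+2) n).
  apply/funext => n; rewrite /series/= big_distrr/=.
  by apply: eq_bigr => j _; rewrite mulrA Ha.
by apply: cvgM; [exact: cvg_cst|apply: Hv; exact: alT].
Qed.

Lemma ode_cat a b v : ode_solution T (path_cat a b) v ->
  ode_solution T a (fun x => v (2^-1 * x + 0)) /\
  ode_solution T b (fun x => v (2^-1 * x + T / 2)).
Proof.
move=> sv; split.
  exact: (ode_affine n2 half_left (cat_left a b)).
exact: (ode_affine n2 half_right (cat_right a b)).
Qed.

Lemma ode_inv a v : ode_solution T (path_inv a) v ->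
  ode_solution T a (fun x => v (-1 * x + T)).
Proof. exact: (ode_affine nN1 reflect_itv (inv_rev a)). Qed.

End Reparam.

(** * The first return map *)

Section Compositions.

(** The words of weight [n], sorted by first letter; [m] is fuel, enough as soon as [n <= m]. *)
Fixpoint comps_rec (m n : nat) : seq word :=
  if n is n'.+1 then
    if m is m'.+1 then [seq j :: w | j <- iota 0 n, w <- comps_rec m' (n - j.+1)]
    else [::]
  else [:: [::]].

Definition comps n := comps_rec n n.

Lemma weight_cons j w : weight (j :: w) = (j.+1 + weight w)%N.
Proof. by rewrite /weight big_cons. Qed.

Lemma mem_comps_rec m n w : (n <= m)%N -> (w \in comps_rec m n) = (weight w == n).
Proof.
elim: m n w => [|m IH] [|n] w // nm.
- by case: w => [|j w]; rewrite ?weight_cons ?/weight ?big_nil ?inE.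
- by case: w => [|j w]; rewrite ?weight_cons ?/weight ?big_nil ?inE.
apply/allpairsPdep/eqP => [[j [w' [jn w'n ->]]]|].
  move: jn w'n; rewrite mem_iota add0n => /andP[_ jn].
  by rewrite IH ?weight_cons => [/eqP ->|]; lia.
case: w => [|j w]; first by rewrite /weight big_nil.
rewrite weight_cons => jw; exists j, w; split=> //.
  by rewrite mem_iota; lia.
by rewrite IH; [apply/eqP|]; lia.
Qed.

Lemma comps_rec_uniq m n : uniq (comps_rec m n).
Proof.
elim: m n => [|m IH] [|n] //.
rewrite -[comps_rec _ _]/[seq j :: w | j <- iota 0 n.+1, w <- comps_rec m (n.+1 - j.+1)].
apply: (@allpairs_uniq_dep nat (fun=> word) word (fun j w => j :: w)) => [|j _|[j w] [j2 w2] _ _ /= [-> ->]] //.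
exact: (iota_uniq 0 n.+1).
Qed.

Lemma mem_comps n w : (w \in comps n) = (weight w == n).
Proof. exact: mem_comps_rec. Qed.

Lemma big_comps0 (V : nmodType) (F : word -> V) : \sum_(w <- comps 0) F w = F [::].
Proof. by rewrite big_seq1. Qed.

Lemma big_compsS (V : nmodType) (F : word -> V) n :
  \sum_(w <- comps n.+1) F w = \sum_(j < n.+1) \sum_(w <- comps (n.+1 - j.+1)) F (val j :: w).
Proof.
rewrite -(big_mkord xpredT (fun j => \sum_(w <- comps (n.+1 - j.+1)) F (j :: w))).
rewrite /comps -[comps_rec n.+1 _]/[seq j :: w | j <- iota 0 n.+1, w <- comps_rec n (n.+1 - j.+1)].
rewrite (@big_allpairs_dep _ _ _ _ (fun=> word)) /index_iota subn0.
apply: eq_bigr => j _; apply: perm_big; apply: uniq_perm; try exact: comps_rec_uniq.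
by move=> w; rewrite !mem_comps_rec//; lia.
Qed.

Lemma size_le_weight w : (size w <= weight w)%N.
Proof. by elim: w => [|j w IH] //; rewrite weight_cons /=; lia. Qed.

Lemma letter_lt_weight w j : j \in w -> (j < weight w)%N.
Proof.
elim: w => [|i w IH] //; rewrite weight_cons inE => /predU1P[->|/IH]; lia.
Qed.

Lemma tuple_of_word i w : (forall j, j \in w -> (j < i)%N) ->
  exists t : (size w).-tuple 'I_i, [seq val x | x <- t] = w.
Proof.
elim: w => [|j w IH] wi; first by exists [tuple].
have [t tw] : exists t : (size w).-tuple 'I_i, [seq val x | x <- t] = w.
  by apply: IH => k kw; apply: wi; rewrite inE kw orbT.
have ji : (j < i)%N by apply: wi; rewrite mem_head.
by exists [tuple of Ordinal ji :: t] => /=; rewrite tw.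
Qed.

(** Brings the sum in [Phat] over lengths and tuples into the form that supports recursion on the
    first letter. Both range over the same words, as a word of weight [i] has length at most [i] and
    letters below [i]. *)
Lemma big_tuple_comps (V : nmodType) (F : word -> V) i :
  \sum_(k < i.+1) \sum_(w : k.-tuple 'I_i | weight [seq val x | x <- w] == i)
    F [seq val x | x <- w] = \sum_(w <- comps i) F w.
Proof.
rewrite [RHS]big_seq.
rewrite [RHS](partition_big (fun w => inord (size w) : 'I_i.+1) predT)//=.
apply: eq_bigr => k _.
pose s := [seq [seq val x | x <- (t : k.-tuple 'I_i)] |
  t <- enum [pred t : k.-tuple 'I_i | weight [seq val x | x <- t] == i]].
have -> : \sum_(w : k.-tuple 'I_i | weight [seq val x | x <- w] == i)
    F [seq val x | x <- w] = \sum_(w <- s) F w.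
  by rewrite big_map big_enum/=; apply: eq_bigl => t; rewrite inE.
rewrite -[RHS]big_filter; apply: perm_big; apply: uniq_perm.
- by rewrite map_inj_uniq ?enum_uniq// => t u /(inj_map val_inj)/val_inj.
- exact: (filter_uniq _ (comps_rec_uniq i i)).
move=> w; rewrite mem_filter mem_comps; apply/mapP/idP.
  move=> [t]; rewrite mem_enum inE => /eqP tw ->; rewrite tw eqxx/= andbT.
  by apply/eqP; rewrite size_map size_tuple inord_val.
move=> /andP[/andP[/eqP wi]]; rewrite wi eqxx => /eqP wk _.
have wsz : size w = k.
  by rewrite -wk inordK// ltnS -wi size_le_weight.
have [t tw] : exists t : (size w).-tuple 'I_i, [seq val x | x <- t] = w.
  by apply: tuple_of_word => j; rewrite -wi; exact: letter_lt_weight.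
move: t tw; rewrite wsz => t tw; exists t => //.
by rewrite mem_enum inE tw wi.
Qed.
End Compositions.

(** * Coefficients of the flow to time T, and centers *)

Section ReturnMap.
Variable R : realType.
Notation C := (Cplx R).
Notation nrm := (@Normc.normc R).
Variable T : R.
Hypothesis T0 : 0 < T.

(** In shifted indices the first factor is n - (j + 1) + 1, and the others are those of [w]
    evaluated at n - (j + 1): precisely the recursion of the transport system. *)
Lemma pcoef_cons j w n : (j < n)%N ->
  pcoef (j :: w) (n%:R : C) = (n - j)%:R * pcoef w (n - j.+1)%:R.
Proof.
move=> jn; have nj : n%:R - j.+1%:R + 1 = (n - j)%:R :> C.
  by rewrite natrB ?(ltnW jn)// -[j.+1]addn1 natrD opprD addrA subrK.
rewrite /pcoef [size _]/= big_ord_recl [take _ _]/= take0; congr (_ * _).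
  by have -> : weight [:: j] = j.+1 by rewrite /weight big_seq1.
apply: eq_bigr => i _; rewrite lift0 [take _ _]/= weight_cons natrD natrB//.
by rewrite opprD addrA.
Qed.

(* The flow from time x to time T is r |-> sum_n return_coef a n x r^(n+1). *)
Definition return_coef (a : coefs R) (n : nat) (x : R) : C :=
  \sum_(w <- comps n) pcoef w n%:R * iterated_from T a w x.

Lemma return_coef0 a x : return_coef a 0 x = 1.
Proof. by rewrite /return_coef big_comps0 /pcoef big_ord0 mulr1. Qed.

Lemma return_coefT a n : return_coef a n.+1 T = 0.
Proof.
rewrite /return_coef big_seq big1// => w; rewrite mem_comps iterated_fromT.
by case: w => [|j w]; [rewrite /weight big_nil|rewrite mulr0].
Qed.

(** Differentiating an iterated integral in its lower limit strips the first letter with a sign, and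
    [pcoef_cons] supplies the factor n - j. *)
Lemma return_coef_transport a : X T a -> transport_system T a (return_coef a).
Proof.
move=> Xa n.
have H := prim_sum (comps n) (fun w => primZ (pcoef w n%:R) (iterated_from_prim w Xa)).
apply: (prim_ext H) => // {H}; apply: aeW => x _; case: n => [|n].
  by rewrite big_comps0 big_ord0 mulr0 oppr0.
rewrite big_compsS -sumrN; apply: eq_bigr => j _.
rewrite /return_coef big_distrr/= -sumrN; apply: eq_bigr => w _.
by rewrite pcoef_cons//; ring.
Qed.

(** The ratio M / K is at most 1/2, so the geometric sum is at most 2. The right-hand side is minus
    the derivative of K(s)^n when K has slope -2 M. *)
Lemma geometric_convolution (M K : R) n : 0 <= M -> 2 * M <= K ->
  \sum_(j < n) M ^+ j.+1 * n%:R * K ^+ (n - j.+1) <= n%:R * K ^+ n.-1 * (2 * M).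
Proof.
move=> M0 MK; case: n => [|n]; first by rewrite big_ord0 !mul0r.
have K0 : 0 <= K by lra.
have [Ke|Kn0] := eqVneq K 0.
  have -> : M = 0 by lra.
  by rewrite mulr0 mulr0 big1// => j _; rewrite expr0n/= !mul0r.
have q0 : 0 <= M / K by rewrite divr_ge0.
have q2 : M / K <= 2^-1.
  by rewrite ler_pdivrMr ?lt_neqAle 1?eq_sym ?Kn0//; lra.
rewrite (@le_trans _ _ (\sum_(j < n.+1) n.+1%:R * K ^+ n * M * (M / K) ^+ j))//.
  apply: ler_sum => j _; rewrite subSS exprS.
  have -> : K ^+ n = K ^+ (n - j) * K ^+ j by rewrite -exprD subnK// leq_ord.
  rewrite expr_div_n le_eqVlt; apply/orP; left; apply/eqP.
  by field; rewrite expf_neq0.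
rewrite -big_distrr/= mulrA [leRHS]mulrAC ler_wpM2l ?geom_sum2//.
by rewrite !mulr_ge0 ?exprn_ge0.
Qed.

(** Backward comparison from time T, where the coefficients of positive index vanish, with the
    majorant K(s)^n, K(s) = 2 M (1 + T - s). The summand 1 keeps K(s) >= 2 M, as the convolution
    estimate requires. *)
Lemma return_coef_bound a M : X T a -> 0 <= M -> geom_bounded T a M ->
  forall n x, 0 <= x <= T -> nrm (return_coef a n x) <= (2 * M * (1 + T - x)) ^+ n.
Proof.
move=> Xa M0 aM n; elim/ltn_ind: n => -[|n] IH x /andP[x0 xT].
  by rewrite return_coef0 expr0 nrm1.
pose K s := 2 * M * (1 + T - s).
have pK : prim T (fun s => toC (- K s ^+ n.+1)) (fun s => toC (n.+1%:R * K s ^+ n * (2 * M))).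
  have p1 : prim T (fun s => toC (K s)) (fun=> - toC (2 * M)).
    have H := primB (prim_cst T (toC (2 * M * (1 + T)))) (primZ (toC (2 * M)) (prim_id T)).
    apply: (prim_ext H); last by apply: aeW => s _; rewrite mulr1 sub0r.
    by move=> s _; rewrite -toCM -toCN -toCD /K; congr toC; ring.
  apply: (prim_ext (primZ (-1) (primX n p1))).
    by move=> s _; rewrite mulN1r toCN toCX.
  by apply: aeW => s _; rewrite [toC (_ * (2 * M))]toCM [toC (_ * K s ^+ n)]toCM toC_nat toCX; ring.
have := prim_growth (x := x) (y := T) (return_coef_transport Xa n.+1) pK.
rewrite return_coefT sub0r nrmN x0 xT lexx opprK => H.
have {}H : nrm (return_coef a n.+1 x) <= - K T ^+ n.+1 + K x ^+ n.+1.
  apply: H => //; have /ae_foralln aM' := aM.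
  apply: ae_weaken aM' => s Ha /andP[xs sT].
  have s0T : 0 <= s <= T by rewrite (le_trans x0 xs).
  have MK : 2 * M <= K s by rewrite /K; nra.
  rewrite nrmN (le_trans (nrm_sum _ _ _))//.
  apply: le_trans (geometric_convolution n.+1 M0 MK).
  apply: ler_sum => j _; rewrite !nrmM nrm_nat.
  rewrite ler_pM ?mulr_ge0 ?nrm_ge0//.
    by rewrite ler_pM ?nrm_ge0 ?Ha// ler_nat leq_subr.
  by apply: IH => //; lia.
apply: le_trans H _; rewrite gerDr oppr_le0 exprn_ge0// /K.
by rewrite mulr_ge0//; lra.
Qed.

Lemma transport_geom a S v (L rho : R) N : 0 <= L -> geom_bounded T a L ->
  transport_system T a S -> (forall n x, 0 <= x <= T -> nrm (S n x) <= L ^+ n) ->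
  ode_solution T a v -> (forall x, 0 <= x <= T -> nrm (v x) <= rho) -> 4 * (L * rho) <= 1 ->
  nrm (\sum_(n < N.+1) S n T * v T ^+ n.+1 - \sum_(n < N.+1) S n 0 * v 0 ^+ n.+1)
    <= rho * T * 2^-1 ^+ N.
Proof.
move=> L0 aL sS SL sv vr Lr.
have rho0 : 0 <= rho by rewrite (le_trans (nrm_ge0 (v 0)))// vr// lexx ltW.
have Lr0 : 0 <= L * rho by rewrite mulr_ge0.
rewrite (le_trans (transport T0 N L0 aL sS SL sv vr _))//; first lra.
have H : (2 * (L * rho)) ^+ N.+1 <= 2^-1 ^+ N.+1.
  by rewrite lerXn2r ?nnegrE ?invr_ge0 ?mulr_ge0//; lra.
have -> : rho * T * 2^-1 ^+ N = 2 * rho * 2^-1 ^+ N.+1 * T by rewrite exprS; field.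
by rewrite ler_wpM2r ?(ltW T0)// ler_wpM2l// mulr_ge0.
Qed.

Lemma big_succ_id (z : C) (S : nat -> C) N : S 0 = 1 -> (forall n, S n.+1 = 0) ->
  \sum_(n < N.+1) S n * z ^+ n.+1 = z.
Proof.
move=> S0 SS; rewrite big_ord_recl/= S0 mul1r expr1 big1 ?addr0// => i _.
by rewrite SS mul0r.
Qed.

(** The constant 64 is dictated by [ode_exists] at radius 2 rho, whose condition reads 64 L rho T <=
    1; the other smallness conditions are weaker. *)
Definition small_radius (L : R) : R := (64 * L * (1 + T))^-1.

Lemma small_radiusP L rho : 1 <= L -> 0 < rho -> rho <= small_radius L ->
  64 * (L * rho) <= 1 /\ 64 * (L * rho) * T <= 1.
Proof.
move=> L1 rho0; rewrite /small_radius.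
have LT : 0 < 64 * L * (1 + T) by rewrite !mulr_gt0//; (have := T0; lra).
rewrite -[_^-1]mul1r ler_pdivlMr// => H.
have Lr : 0 < L * rho by rewrite mulr_gt0//; (have := T0; lra).
have LrT : 0 < L * rho * T by rewrite mulr_gt0.
by split; (have := T0; lra).
Qed.

Lemma small_radius_gt0 L : 1 <= L -> 0 < small_radius L.
Proof. by move=> L1; rewrite invr_gt0 !mulr_gt0//; (have := T0; lra). Qed.

Lemma X_radius a : X T a -> exists2 L, 1 <= L & geom_bounded T a L /\
  forall n x, 0 <= x <= T -> nrm (return_coef a n x) <= L ^+ n.
Proof.
move=> Xa; have /X_normP[am [M M1 aM]] := Xa.
have ML : M <= 2 * M * (1 + T) by (have := T0; nra).
exists (2 * M * (1 + T)); first (have := T0; lra).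
split.
  move=> j; apply: ae_weaken (aM j) => x H /H {}H; rewrite (le_trans H)//.
  by rewrite lerXn2r ?nnegrE//; (have := T0; lra).
move=> n x /andP[x0 xT].
have M0 : 0 <= M by (have := T0; lra).
rewrite (le_trans (return_coef_bound Xa M0 aM _ _)) ?x0//.
rewrite lerXn2r ?nnegrE//; last by rewrite ler_wpM2l//; (have := T0; lra).
  by rewrite mulr_ge0//; (have := T0; lra).
by rewrite mulr_ge0//; (have := T0; lra).
Qed.

(** At time T the flow is the identity series, so the conserved sum reduces there to [v T]. *)
Lemma return_map a L rho v N : X T a -> 1 <= L -> geom_bounded T a L ->
  (forall n x, 0 <= x <= T -> nrm (return_coef a n x) <= L ^+ n) ->
  0 < rho -> rho <= small_radius L -> ode_solution T a v -> nrm (v 0) <= rho ->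
  nrm (v T - \sum_(n < N.+1) return_coef a n 0 * v 0 ^+ n.+1) <= 2 * rho * T * 2^-1 ^+ N.
Proof.
move=> Xa L1 aL rL rho0 rhoL sv v0.
have [r1 r2] := small_radiusP L1 rho0 rhoL.
have Lr : 0 < L * rho by rewrite mulr_gt0//; (have := T0; lra).
have L0 : 0 <= L by (have := T0; lra).
have vb x : 0 <= x <= T -> nrm (v x) <= 2 * rho.
  by move=> xT; apply: (ode_small L0 aL sv rho0 v0) => //; lra.
have := transport_geom N L0 aL (return_coef_transport Xa) rL sv vb.
rewrite (@big_succ_id (v T) (fun n => return_coef a n T)); [|exact: return_coef0|by move=> n; exact: return_coefT].
by apply; (have := T0; lra).
Qed.

(** Once the lower coefficients vanish, the solution starting at rho, supplied by [ode_exists],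
    returns to rho, and the transport estimate gives |c| rho^(n+2) <= B rho^(n+3) for the next
    coefficient c. Then rho tends to 0. *)
Lemma center_return_coef a : X T a -> determines_center T a -> forall n, return_coef a n.+1 0 = 0.
Proof.
move=> Xa [eps eps0 ceps] n; elim/ltn_ind: n => n IH.
have [L L1 [aL rL]] := X_radius Xa.
have /X_normP[am _] := Xa.
have L0 : 0 <= L by (have := T0; lra).
pose B := 4 * (4 * L) ^+ n.+2 * T.
have B0 : 0 <= B by rewrite /B mulr_ge0 ?(ltW T0)// mulr_ge0// exprn_ge0// mulr_ge0.
have key rho : 0 < rho -> rho <= small_radius L -> rho < eps ->
    nrm (return_coef a n.+1 0) <= B * rho.
  move=> rho0 rhoL rhoe.
  have [r1 r2] := small_radiusP L1 rho0 rhoL.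
  have Lr : 0 < L * rho by rewrite mulr_gt0//; (have := T0; lra).
  have nr : nrm (toC rho) = rho by rewrite nrm_toC gtr0_norm.
  have [v [sv v0]] : exists v, ode_solution T a v /\ v 0 = toC rho.
    apply: (ode_exists (M := L) (rho := 2 * rho) T0 am) => //; rewrite ?nr; (have := T0; lra).
  have vT : v T = v 0 by apply: ceps => //; rewrite v0 nr.
  have vb x : 0 <= x <= T -> nrm (v x) <= 2 * rho.
    by move=> xT; apply: (ode_small L0 aL sv rho0) => //; rewrite ?v0 ?nr //; lra.
  have := transport T0 n.+1 L0 aL (return_coef_transport Xa) rL sv vb.
  rewrite (@big_succ_id (v T) (fun n => return_coef a n T)); [|exact: return_coef0|by move=> k; exact: return_coefT].
  rewrite big_ord_recl big_ord_recr/= big1 ?add0r => [|i _]; last first.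
    by rewrite /bump/= add1n IH ?mul0r// ltn_ord.
  rewrite return_coef0 mul1r expr1 vT opprD addrA subrr add0r nrmN nrmM nrmX v0 nr /bump/= !add1n => H.
  have rn : 0 < rho ^+ n.+2 by rewrite exprn_gt0.
  rewrite -(ler_pM2r rn); apply: le_trans (H _) _; first (have := T0; lra).
  have -> : 2 * (2 * rho) * (2 * (L * (2 * rho))) ^+ n.+2 * T = B * rho * rho ^+ n.+2.
    have -> : 2 * (L * (2 * rho)) = 4 * L * rho by ring.
    by rewrite /B exprMn; ring.
  by [].
apply: nrm_eq0; apply/le_anti; rewrite nrm_ge0 andbT.
apply/ler_addgt0Pr => e e0; rewrite add0r.
have B1 : 0 < B + 1 by (have := T0; lra).
have sL := small_radius_gt0 L1.
pose rho := Num.min (Num.min (small_radius L) (eps / 2)) (e / (B + 1)).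
have rho0 : 0 < rho by rewrite !lt_min sL !divr_gt0.
have rho1 : rho <= small_radius L by rewrite !ge_min lexx.
have rho2 : rho < eps by rewrite !gt_min ltr_pdivrMr// mulr_natr mulr2n ltrDl eps0 orbT.
have rho3 : rho * (B + 1) <= e by rewrite -ler_pdivlMr// ge_min lexx orbT.
by rewrite (le_trans (key rho rho0 rho1 rho2))//; (have := T0; nra).
Qed.

End ReturnMap.

(** * Correcting a path into a center *)

(** [tab n] tabulates the first [n] values over the default [d]; since [f n] consults only earlier
    values, all tables agree. The coefficients of the correcting path are defined this way, each
    from all previous ones. *)
Lemma strong_recursion (A : Type) (d : A) (f : nat -> (nat -> A) -> A) :
  (forall n g g', (forall k, (k < n)%N -> g k = g' k) -> f n g = f n g') ->
  exists b, forall n, b n = f n b.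
Proof.
move=> ff.
pose tab := fix tab n : nat -> A :=
  if n is n'.+1 then fun k => if k == n' then f n' (tab n') else tab n' k else fun=> d.
have tabP n k : (k < n)%N -> tab n k = tab k.+1 k.
  elim: n => // n IH; rewrite ltnS leq_eqVlt => /predU1P[->//|kn].
  by rewrite [LHS]/= ltn_eqF// IH.
exists (fun k => tab k.+1 k) => n; rewrite [LHS]/= eqxx.
by apply: ff => k kn; rewrite tabP.
Qed.

Section Correction.
Variable R : realType.
Notation C := (Cplx R).
Notation nrm := (@Normc.normc R).
Variable T : R.
Hypothesis T0 : 0 < T.
Variable q : nat -> C.

(* The coefficients of - U_x / U_y for U(x, y) = y + (x/T) sum_(n >= 1) q_n y^(n+1);
   U is constant along the solutions of the resulting equation. *)
Definition correction (b : coefs R) := forall m x, b m x =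
  - (toC T^-1 * q m.+1)
  - \sum_(j < m) b j x * (m.+1 - j)%:R * (toC (x / T) * q (m - j)%N).

Lemma correction_exists : exists b, correction b.
Proof.
pose f (m : nat) (g : nat -> R -> C) : R -> C := fun x => - (toC T^-1 * q m.+1)
  - \sum_(j < m) g j x * (m.+1 - j)%:R * (toC (x / T) * q (m - j)%N).
have [|b Hb] := @strong_recursion (R -> C) (fun=> 0) f.
  move=> n g g' gg'; apply/funext => x; rewrite /f; congr (_ - _).
  by apply: eq_bigr => j _; rewrite gg'.
by exists b => m x; rewrite {1}Hb.
Qed.

Variable b : coefs R.
Hypothesis bq : correction b.

(** The coefficient of y^(n+1) in U(x, y); that of y is 1 at all times. *)
Definition correction_flow (n : nat) (x : R) : C :=
  if n is 0 then 1 else toC (x / T) * q n.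

Lemma correction_flow_prim n :
  prim T (correction_flow n) (fun=> if n is 0 then 0 else toC T^-1 * q n).
Proof.
case: n => [|n]; first exact: prim_cst.
apply: (prim_ext (primZ (toC T^-1 * q n.+1) (prim_id T))).
  by move=> x _; rewrite /correction_flow toCM; ring.
by apply: aeW => x _; rewrite mulr1.
Qed.

(** This is U_x + (sum_j b_j y^(j+2)) U_y = 0 by coefficients. In the equation of index m + 1 the
    last summand is [b m] itself, and [correction] is that equation solved for it. *)
Lemma correction_transport : transport_system T b correction_flow.
Proof.
move=> n; apply: (prim_ext (correction_flow_prim n)) => //.
apply: aeW => x _; case: n => [|m]; first by rewrite big_ord0 oppr0.
rewrite big_ord_recr/= subSnn subnn mulr1 mulr1 bq.
rewrite [X in - (X + _)](_ : _ =
  \sum_(j < m) b j x * (m.+1 - j)%:R * (toC (x / T) * q (m - j)%N)); first by ring.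
apply: eq_bigr => j _; congr (_ * _); rewrite subSS /correction_flow.
by have := ltn_ord j; rewrite -subn_gt0; case: (m - j)%N.
Qed.

Lemma correction_meas m : cmeas T (b m).
Proof.
elim/ltn_ind: m => m IH.
have lx c : cmeas T (fun x => toC (x / T) * c).
  apply: lip_cmeas; apply: lip_ext (prim_lip (primZ (toC T^-1 * c) (prim_id T))).
  by move=> x _; rewrite toCM; ring.
have ms : cmeas T (fun x => \sum_(j < m) (-1 * (m.+1 - j)%:R) * b j x * (toC (x / T) * q (m - j)%N)).
  apply: (@cmeas_sum _ _ _ _ (fun (j : 'I_m) x => _)) => j.
  by apply: cmeasM; [apply: cmeasM; [exact: cmeas_cst|exact: IH]|exact: lx].
apply: (cmeas_eq _ (cmeasD (cmeas_cst _ (- (toC T^-1 * q m.+1))) ms)) => x.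
rewrite bq; congr (_ + _); rewrite -sumrN; apply: eq_bigr => j _; ring.
Qed.

(** Each of the two parts of the recursion is given half of d B^(m+1): K / T <= B / 2 handles the
    term q / T, and 2 K <= B / 4 makes the convolution a geometric sum of ratio 1/4. The smallness
    [d] survives because [d <= 1] lets every product keep just the factor [d] of [b j]. *)
Lemma correction_bound (K d : R) N : 1 <= K -> 0 <= d -> d <= 1 ->
  (forall m, (m < N)%N -> nrm (q m.+1) <= d * K ^+ m.+1) ->
  forall m x, (m < N)%N -> 0 <= x <= T -> nrm (b m x) <= d * (8 * K + 2 * (K / T)) ^+ m.+1.
Proof.
move=> K1 d0 d1 qK m x mN xT; set B := 8 * K + 2 * (K / T).
have KT : 0 < K / T by rewrite divr_gt0//; lra.
have BK : 8 * K <= B by rewrite /B; lra.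
have B0 : 0 < B by rewrite /B; lra.
have xT1 : nrm (toC (x / T)) <= 1.
  move: xT => /andP[x0 xT]; rewrite nrm_toC ger0_norm ?divr_ge0 ?(ltW T0)//.
  by rewrite ler_pdivrMr// mul1r.
elim/ltn_ind: m mN => m IH mN; rewrite bq.
have K0 : 0 <= K by lra.
have H1 : nrm (toC T^-1 * q m.+1) <= d * B ^+ m.+1 / 2.
  rewrite nrmM nrm_toC ger0_norm ?invr_ge0 ?(ltW T0)//.
  have := ler_wpM2l (ltW (_ : 0 < T^-1)) (qK m mN); rewrite invr_gt0 => /(_ T0) H.
  apply: le_trans H _; rewrite !exprS.
  have -> : T^-1 * (d * (K * K ^+ m)) = d * K ^+ m * (K / T) by ring.
  have -> : d * (B * B ^+ m) / 2 = d * B ^+ m * (B / 2) by ring.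
  rewrite ler_pM ?(ltW KT) ?mulr_ge0 ?exprn_ge0//; last by rewrite /B; lra.
  by rewrite ler_wpM2l// lerXn2r ?nnegrE//; lra.
have H2 : nrm (\sum_(j < m) b j x * (m.+1 - j)%:R * (toC (x / T) * q (m - j)%N))
    <= d * B ^+ m.+1 / 2.
  rewrite (le_trans (nrm_sum _ _ _))//.
  rewrite (@le_trans _ _ (\sum_(j < m) d * B ^+ m.+1 * 4^-1 * 4^-1 ^+ (m - j.+1)))//.
    apply: ler_sum => j _; rewrite !nrmM nrm_nat.
    have jm := ltn_ord j.
    have bj : nrm (b j x) <= d * B ^+ j.+1 by apply: IH => //; exact: ltn_trans mN.
    have nj : ((m.+1 - j)%:R : R) <= 2 ^+ (m - j).
      by rewrite subSn ?(ltnW jm)// natr_le_pow2.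
    have qj : nrm (q (m - j)%N) <= K ^+ (m - j).
      rewrite -(subnSK jm) (le_trans (qK _ _))//.
        by rewrite (leq_ltn_trans (leq_subr _ _)).
      by rewrite ler_piMl ?exprn_ge0.
    have xq : nrm (toC (x / T)) * nrm (q (m - j)%N) <= 1 * K ^+ (m - j).
      by rewrite ler_pM ?nrm_ge0.
    have -> : d * B ^+ m.+1 * 4^-1 * 4^-1 ^+ (m - j.+1) =
       d * B ^+ j.+1 * (B / 4) ^+ (m - j).
      rewrite -mulrA -exprS.
      rewrite subnSK// -{1}(subnKC (ltnW jm)) -addSn exprD expr_div_n exprVn; ring.
    rewrite -mulrA.
    have H3 : (m.+1 - j)%:R * (nrm (toC (x / T)) * nrm (q (m - j)%N)) <= (B / 4) ^+ (m - j).
      rewrite (@le_trans _ _ (2 ^+ (m - j) * (1 * K ^+ (m - j))))//.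
        by rewrite ler_pM// mulr_ge0 ?nrm_ge0.
      by rewrite mul1r -exprMn lerXn2r ?nnegrE//; lra.
    by rewrite ler_pM ?nrm_ge0// mulr_ge0// mulr_ge0 ?nrm_ge0.
  rewrite -big_distrr/= (reindex_inj rev_ord_inj)/=.
  rewrite (eq_bigr (fun i : 'I_m => (4^-1 : R) ^+ i)); last first.
    by move=> i _; rewrite subnSK// subKn// ltnW.
  have S4 : \sum_(i < m) (4^-1 : R) ^+ i <= 2 by apply: geom_sum2; lra.
  have dB : 0 <= d * B ^+ m.+1 by rewrite mulr_ge0 ?exprn_ge0 ?(ltW B0).
  have -> : d * B ^+ m.+1 / 2 = d * B ^+ m.+1 * 4^-1 * 2 by field.
  by rewrite ler_wpM2l// mulr_ge0.
rewrite -opprD nrmN (le_trans (nrmD _ _))//; lra.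
Qed.

End Correction.

(** * The corrected path is a center *)

Section CorrectedCenter.
Variable R : realType.
Notation nrm := (@Normc.normc R).
Variable T : R.
Hypothesis T0 : 0 < T.
Variables a b : coefs R.
Hypotheses (Xa : X T a) (bq : correction T (fun n => return_coef T a n 0) b).

Lemma correction_radius : exists2 B, 1 <= B & geom_bounded T b B /\
  forall n x, 0 <= x <= T -> nrm (correction_flow T (fun n => return_coef T a n 0) n x) <= B ^+ n.
Proof.
have [L L1 [aL rL]] := X_radius T0 Xa.
have T00 : 0 <= (0 : R) <= T by rewrite lexx ltW.
have LT : 0 < L / T by rewrite divr_gt0//; lra.
exists (8 * L + 2 * (L / T)); first lra.
split=> [j|n x xT].
  apply: aeW => x xT; rewrite -[leRHS]mul1r.
  apply: (correction_bound T0 bq (N := j.+1)) => // m _.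
  by rewrite mul1r rL.
case: n => [|n]; first by rewrite expr0 nrm1.
move: xT => /andP[x0 xT]; rewrite nrmM nrm_toC ger0_norm ?divr_ge0 ?(ltW T0)//.
rewrite -[leRHS]mul1r ler_pM ?divr_ge0 ?(ltW T0) ?nrm_ge0//.
  by rewrite ler_pdivrMr// mul1r.
by rewrite (le_trans (rL _ _ T00))// lerXn2r ?nnegrE//; lra.
Qed.

Lemma X_correction : X T b.
Proof.
have [B B1 [bB _]] := correction_radius; apply/X_normP; split; last by exists B.
exact: correction_meas bq.
Qed.

(** With P the return map of [a] and z the value of [v] at half time, conservation of U on the first
    half gives P(z) = v(0), and the second half gives v(T) = P(z). Both are compared with the same
    truncation of P, with errors of order 2^-N. *)
Lemma correction_center : determines_center T (path_cat T b a).
Proof.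
have [B B1 [bB uB]] := correction_radius.
have [L L1 [aL rL]] := X_radius T0 Xa.
have B0 : 0 <= B by lra.
(* Half the radius of [a], because |v| may have doubled by half time. *)
pose rho := Num.min (small_radius T B) (small_radius T L / 2).
have rho0 : 0 < rho by rewrite lt_min divr_gt0 ?small_radius_gt0.
have rho1 : rho <= small_radius T B by rewrite ge_min lexx.
have rho2 : 2 * rho <= small_radius T L.
  by rewrite mulrC -ler_pdivlMr// ge_min lexx orbT.
exists rho => // v /ode_cat[s1 s2] v0.
set v1 := fun x => _ in s1; set v2 := fun x => _ in s2.
have v10 : v1 0 = v 0 by rewrite /v1 mulr0 addr0.
have v2T : v2 T = v T by rewrite /v2; congr v; field.
have v12 : v1 T = v2 0 by rewrite /v1 /v2; congr v; field.
have [r1 r2] := small_radiusP T0 B1 rho0 rho1.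
have Br : 0 < B * rho by rewrite mulr_gt0//; lra.
have v1b x : 0 <= x <= T -> nrm (v1 x) <= 2 * rho.
  by move=> xT; apply: (ode_small B0 bB s1 rho0) => //; rewrite ?v10 ?ltW//; lra.
have w0 : nrm (v2 0) <= 2 * rho by rewrite -v12 v1b// lexx ltW.
have rho0' : 0 < 2 * rho by rewrite mulr_gt0.
have Br4 : 4 * (B * (2 * rho)) <= 1 by lra.
have H1 N := transport_geom T0 N B0 bB (correction_transport bq) uB s1 v1b Br4.
have H2 N := return_map T0 N Xa L1 aL rL rho0' rho2 s2 w0.
apply/eqP; rewrite -subr_eq0; apply/eqP/nrm_eq0/le_anti; rewrite nrm_ge0 andbT.
apply/ler_addgt0Pr => e e0; rewrite add0r.
(* 2 rho T from the first half plus 4 rho T from the second, which runs at radius 2 rho. *)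
have [N HN] := half_pow_small (6 * rho * T) e0.
have {}H1 : nrm (\sum_(n < N.+1) return_coef T a n 0 * v2 0 ^+ n.+1 - v 0) <= 2 * rho * T * 2^-1 ^+ N.
  have := H1 N; rewrite v12 v10.
  rewrite (@big_succ_id _ (v 0) (fun n => correction_flow T _ n 0)) => [H||n]; last 2 first.
  - by [].
  - by rewrite /correction_flow mul0r toC0 mul0r.
  rewrite (eq_bigr (fun n : 'I_N.+1 => return_coef T a n 0 * v2 0 ^+ n.+1)) in H.
    exact: H.
  move=> [[|n] nN] _ /=; first by rewrite return_coef0.
  by rewrite divff ?gt_eqF// toC1 mul1r.
rewrite -v2T.
have -> : v2 T - v 0 = (v2 T - \sum_(n < N.+1) return_coef T a n 0 * v2 0 ^+ n.+1)
  + (\sum_(n < N.+1) return_coef T a n 0 * v2 0 ^+ n.+1 - v 0) by ring.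
rewrite (le_trans (nrmD _ _))// (le_trans (lerD (H2 N) H1))//.
by apply: le_trans (ltW HN); rewrite -mulrDl; lra.
Qed.

End CorrectedCenter.

(** * The topology of formal paths *)

Section Topology.
Variable R : realType.
Notation C := (Cplx R).
Notation nrm := (@Normc.normc R).

Lemma ncseries_cvgP (F : set_system (ncseries R)) (f : ncseries R) : Filter F ->
  (F --> f) <-> forall w, (fun g : ncseries R => g w) @ F --> f w.
Proof.
move=> FF; rewrite cvg_sup; split.
  move=> + w => /(_ w).
  rewrite cvg_image; last by rewrite eqEsubset; split=> v // _; exists (fun=> v).
  apply: cvg_trans => W /=; rewrite ?nbhs_simpl /fmap /= => [[W' + <-]].
  by apply: filterS => g W'g /=; exists g.
move=> + w => /(_ w) H.
rewrite cvg_image; last by rewrite eqEsubset; split=> v // _; exists (fun=> v).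
move=> W //=; rewrite ?nbhs_simpl => Q; have Q' := H W Q; exists (@^~ w @^-1` W) => //.
by rewrite eqEsubset; split => [j [? + <-//]|j Wj]; exists (fun _ => j).
Qed.

Lemma coef_continuous w : continuous (fun g : ncseries R => g w : C).
Proof.
move=> g; have [H _] := @ncseries_cvgP (nbhs g) g (nbhs_filter g).
exact: (H (fun A => id) w).
Qed.

Lemma near_coef (g : ncseries R) w (e : R) : 0 < e ->
  \forall h \near g, nrm (h w - g w) < e.
Proof.
move=> e0; have e0' : 0 < toC e :> C by rewrite ltcE/= eqxx e0.
have /cvgrPdist_lt/(_ _ e0') := @coef_continuous w g.
by apply: filterS => h /=; rewrite cplx_normE ltcE/= => /andP[_]; rewrite nrm_dist.
Qed.

Definition low_words N : seq word := flatten [seq comps n | n <- iota 0 N.+1].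

Lemma mem_low_words N w : (w \in low_words N) = (weight w <= N)%N.
Proof.
apply/flatten_mapP/idP => [[n]|wN].
  by rewrite mem_iota mem_comps => /andP[_ nN] /eqP ->.
by exists (weight w); rewrite ?mem_iota ?mem_comps.
Qed.

(** Only finitely many words have weight at most [N], so these conditions are neighbourhoods of the
    product topology. Conversely, approximations to weight n within 1 / (n + 1) form a sequence
    converging to [g]. *)
Lemma closure_coefP (S : set (ncseries R)) (g : ncseries R) : closure S g <->
  forall N (e : R), 0 < e ->
    exists2 h, S h & forall w, (weight w <= N)%N -> nrm (h w - g w) < e.
Proof.
split.
  move=> Sg N e e0.
  have near_seq (s : seq word) : \forall h \near g, forall w, w \in s -> nrm (h w - g w) < e.
    elim: s => [|w s IH]; first by apply: (@filterE _ (nbhs g) (nbhs_filter g)) => h w; rewrite in_nil.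
    have := @filterI _ (nbhs g) (nbhs_filter g) _ _ (near_coef g w e0) IH.
    apply: (@filterS _ (nbhs g) (nbhs_filter g)) => h [H1 H2] w'.
    by rewrite inE => /predU1P[->//|/H2].
  have [h [Sh Hh]] := Sg _ (near_seq (low_words N)).
  by exists h => // w wN; apply: Hh; rewrite mem_low_words.
move=> H A Ag.
have step n : exists h, S h /\ forall w, (weight w <= n)%N -> nrm (h w - g w) < n.+1%:R^-1.
  by have [h Sh Hh] := H n n.+1%:R^-1 (ltac:(by rewrite invr_gt0)); exists h.
have [u Hu] := choice step.
have ug : u @ \oo --> g.
  apply/ncseries_cvgP => w; apply/cplx_cvgP => e e0.
  exists (maxn (weight w) (Num.bound e^-1)) => n; rewrite geq_max => /andP[wn en].
  rewrite nrm_dist (lt_le_trans ((Hu n).2 w wn))//.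
  rewrite invf_ple ?posrE//.
  have := archi_boundP (ltW (_ : 0 < e^-1)); rewrite invr_gt0 => /(_ e0) /ltW He.
  by rewrite (le_trans He)// ler_nat; lia.
have [N _ HN] := ug _ Ag.
by exists (u N); split; [exact: (Hu N).1|exact: HN (leqnn N)].
Qed.

Variable T : R.
Hypothesis T0 : 0 < T.

Lemma X_zero : X T (fun _ _ => 0).
Proof.
apply/X_normP; split; first by move=> j; exact: cmeas_cst.
by exists 1 => // j; apply: aeW => x _; rewrite nrm0 expr1n.
Qed.

Lemma E_ncgroup a : X T a -> ncgroup (E T a).
Proof. by move=> Xa; rewrite /ncgroup/= E_pathc. Qed.

Lemma GX_GfX a : X T a -> GfX T (E T a).
Proof.
move=> Xa; split; first exact: E_ncgroup.
by apply: subset_closure; exists a.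
Qed.

(** Both sides are continuous and agree on [GX], hence on its closure, the target being Hausdorff.
    The word is reversed because its first letter carries the earliest time in [iterated], but the
    latest time in a path coefficient. *)
Lemma Ihat_GfX w g : GfX T g -> Ihat T w g = g (rev w).
Proof.
move=> Gg; rewrite /Ihat; set P := (X in xget _ X).
have Pev : P (fun g => g (rev w)).
  split; first by apply: continuous_subspaceT; exact: coef_continuous.
  by move=> a Xa; rewrite iterated_pathc// E_pathc.
have [fc fE] := xgetPex (fun=> 0) (ex_intro P _ Pev).
set f := xget _ P in fc fE *.
have Bg : ProperFilter (within (GX T) (nbhs g)).
  apply: within_nbhs_proper; exact: Gg.2.
have GXG : GX T `<=` GfX T by move=> _ [a Xa <-]; exact: GX_GfX.
have c1 : f @ within (GX T) (nbhs g) --> f g.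
  have : f @ within (GfX T) (nbhs g) --> f g.
    by have := (proj1 (subspace_continuousP _ _) fc) g Gg.
  move=> fg A /fg; apply: (@filterS _ (nbhs g) (nbhs_filter g)) => h Hh /GXG.
  exact: Hh.
have c2 : f @ within (GX T) (nbhs g) --> (g (rev w) : C).
  have c3 : (fun h : ncseries R => h (rev w) : C) @ within (GX T) (nbhs g) --> g (rev w).
    move=> A /(@coef_continuous (rev w) g).
    by apply: (@filterS _ (nbhs g) (nbhs_filter g)) => h Hh _.
  move=> A /c3; apply: (@filterS _ (nbhs g) (nbhs_filter g)) => h Hh GXh.
  have /= := Hh GXh; case: GXh => a Xa <-.
  by rewrite fE// iterated_pathc// -E_pathc.
exact: (cvg_unique (@norm_hausdorff _ C) c1 c2).
Qed.

Lemma Phat_GfX g i : GfX T g ->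
  Phat T g i.+2 = \sum_(w <- comps i.+1) pcoef w i.+1%:R * g (rev w).
Proof.
move=> Gg; rewrite -(big_tuple_comps (fun w => pcoef w i.+1%:R * g (rev w))).
rewrite /Phat; apply: eq_bigr => k _; apply: eq_bigr => w _.
by rewrite Ihat_GfX.
Qed.

Lemma Phat_E a i : X T a -> Phat T (E T a) i.+2 = return_coef T a i.+1 0.
Proof.
move=> Xa; rewrite Phat_GfX; last exact: GX_GfX.
by apply: eq_bigr => w _; rewrite E_pathc// -iterated_pathc.
Qed.

End Topology.

(** * Centers *)

Section Centers.
Variable R : realType.
Notation mu := (@lebesgue_measure R).
Notation C := (Cplx R).
Notation nrm := (@Normc.normc R).
Variable T : R.
Hypothesis T0 : 0 < T.

Lemma weight_take_drop k w : weight w = (weight (take k w) + weight (drop k w))%N.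
Proof. by rewrite /weight -{1}(cat_take_drop k w) big_cat. Qed.

Lemma weight_rev w : weight (rev w) = weight w.
Proof. by rewrite /weight big_rev. Qed.

Lemma Chat_sub : Chat T `<=` Chat_f T.
Proof.
move=> _ [a [Xa ca] <-]; split; first exact: GX_GfX.
apply/funext => -[|[|i]] //.
by rewrite Phat_E// center_return_coef.
Qed.

Lemma center_zero : center_set T (fun _ _ => 0).
Proof.
split; first exact: X_zero.
exists 1 => // v /ode_solutionP[g pv sg] _.
have g0 : {ae mu, forall x, 0 <= x <= T -> 0 = g x}.
  apply: ae_weaken sg => x H /H Hg.
  have s0 : series (fun j => (0 : C) * v x ^+ j.+2) = fun=> 0.
    by apply/funext => n; rewrite /series/= big1// => j _; rewrite mul0r.
  have c0 : (fun _ : nat => 0 : C) @ \oo --> (0 : C) by exact: cvg_cst.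
  by rewrite s0 in Hg; exact: (cvg_unique (@norm_hausdorff _ C) c0 Hg).
by apply: (prim_unique pv (prim_ext (prim_cst T (v 0)) _ g0)) => //; rewrite lexx ltW.
Qed.

Lemma E_zero : E T (fun _ _ => 0) = ncone R.
Proof.
apply/funext => w; rewrite E_pathc//; last exact: X_zero.
have s0 : lin_sol T (fun _ _ => 0) (fun _ : R => ncone R).
  move=> w'; apply: (prim_ext (prim_cst T (ncone R w'))) => //.
  by apply: aeW => x _; case: w' => //= j w'; rewrite mul0r.
rewrite (lin_sol_unique (pathc_sol (@X_zero R T)) s0) ?lexx ?ltW// => w'.
by rewrite pathc0.
Qed.

Lemma center_cat a b : center_set T a -> center_set T b -> center_set T (path_cat T a b).
Proof.
move=> [Xa [e1 e10 c1]] [Xb [e2 e20 c2]]; split; first exact: X_cat.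
exists (Num.min e1 e2) => [|v /ode_cat[s1 s2]]; first by rewrite lt_min e10.
rewrite lt_min => /andP[v1 v2].
have h1 : v (2^-1 * T + 0) = v 0 by have := c1 _ s1; rewrite mulr0 addr0; exact.
have mid : 2^-1 * T + 0 = T / 2 :> R by rewrite addr0 mulrC.
have := c2 _ s2; rewrite mulr0 add0r -mid h1 => /(_ v2).
by congr (v _ = _); field.
Qed.

(** The reversed solution starts at [v T], which must itself be small before the center condition of
    [a] applies; [ode_small] provides this. *)
Lemma center_inv a : center_set T a -> center_set T (path_inv T a).
Proof.
move=> [Xa [e e0 ca]]; have Xi := X_inv Xa; split=> //.
have [L L1 [iL _]] := X_radius T0 Xi.
have L0 : 0 <= L by lra.
pose rho := Num.min (small_radius T L) (e / 4).
have rho0 : 0 < rho by rewrite lt_min small_radius_gt0//= divr_gt0.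
have rho1 : rho <= small_radius T L by rewrite ge_min lexx.
have rho2 : rho <= e / 4 by rewrite ge_min lexx orbT.
have [r1 r2] := small_radiusP T0 L1 rho0 rho1.
have Lr : 0 < L * rho by rewrite mulr_gt0//; lra.
exists rho => // v sv v0.
have vT : nrm (v T) <= 2 * rho.
  by apply: (ode_small L0 iL sv rho0 (ltW v0)); rewrite ?lexx ?ltW//; lra.
have := ca _ (ode_inv sv).
have -> : -1 * 0 + T = T by ring.
have -> : -1 * T + T = 0 by ring.
by move=> ->//; lra.
Qed.

Lemma Chat_subgroup : is_subgroup (Chat T).
Proof.
split.
- by move=> _ [a [Xa _] <-]; exact: E_ncgroup.
- by exists (fun _ _ => 0); [exact: center_zero|exact: E_zero].
- move=> _ _ [a ca <-] [b cb <-]; exists (path_cat T b a); first exact: center_cat.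
  by rewrite E_cat//; [exact: cb.1|exact: ca.1].
- move=> _ [a ca <-]; exists (E T (path_inv T a)); split.
  + by exists (path_inv T a) => //; exact: center_inv.
  + by rewrite E_inv//; exact: ca.1.
  + by rewrite E_invl//; exact: ca.1.
Qed.


(** The same linear combination of coefficients vanishes at [g], so it may be evaluated at
    [E T a - g]. The constant sums over all low words to be independent of [n]. *)
Lemma return_coef_small (a : coefs R) (g : ncseries R) (d : R) N : X T a -> Chat_f T g ->
  (forall w, (weight w <= N)%N -> nrm (E T a w - g w) <= d) ->
  forall n, (n < N)%N ->
    nrm (return_coef T a n.+1 0) <= (\sum_(w <- low_words N) nrm (pcoef w (weight w)%:R : C)) * d.
Proof.
move=> Xa [Gg Pg] agd n nN.
have -> : return_coef T a n.+1 0 =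
    \sum_(w <- comps n.+1) pcoef w n.+1%:R * (E T a (rev w) - g (rev w)).
  rewrite -Phat_E// Phat_GfX//; last exact: GX_GfX.
  under [RHS]eq_bigr do rewrite mulrBr.
  by rewrite sumrB -[X in _ - X](Phat_GfX T0 n Gg) Pg subr0.
apply: le_trans (nrm_sum _ _ _) _.
rewrite (@le_trans _ _ (\sum_(w <- comps n.+1) nrm (pcoef w (weight w)%:R : C) * d))//.
  rewrite big_seq [leRHS]big_seq; apply: ler_sum => w; rewrite mem_comps => /eqP wn.
  by rewrite nrmM wn ler_wpM2l ?nrm_ge0// agd// weight_rev wn.
rewrite -big_distrl/= ler_wpM2r//.
  by apply: le_trans (agd [::] _); rewrite ?nrm_ge0// /weight big_nil.
rewrite /low_words [leRHS]big_flatten [leRHS]big_map.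
have nN1 : n.+1 \in iota 0 N.+1 by rewrite mem_iota.
rewrite [leRHS](big_rem n.+1 nN1)/= lerDl.
by apply: sumr_ge0 => i _; apply: sumr_ge0 => w _; exact: nrm_ge0.
Qed.

(** The splitting with an empty right part reproduces [f w]; every other one contains a coefficient
    of [h] at a nonempty word. *)
Lemma ncmul_near (f h : ncseries R) (G eps : R) w : h [::] = 1 -> 0 <= G ->
  (forall k, nrm (f (take k w)) <= G) ->
  (forall k, (k < size w)%N -> nrm (h (drop k w)) <= eps) ->
  nrm (ncmul f h w - f w) <= (size w)%:R * (G * eps).
Proof.
move=> h1 G0 fG hs; rewrite /ncmul big_ord_recr/= take_size drop_size h1 mulr1 addrK.
rewrite (le_trans (nrm_sum _ _ _))//.
rewrite (@le_trans _ _ (\sum_(i < size w) G * eps))//.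
  by apply: ler_sum => i _; rewrite nrmM ler_pM ?nrm_ge0// hs.
by rewrite sumr_const card_ord mulr_natl.
Qed.

Lemma Chat_dense : dense_in (Chat_f T) (Chat T).
Proof.
move=> g cg; have [Gg _] := cg; apply/closure_coefP => N e e0.
pose P := \sum_(w <- low_words N) nrm (pcoef w (weight w)%:R : C).
pose G := \sum_(w <- low_words N) nrm (g w).
(* The base of [correction_bound] for K = 1: in low order the return coefficients are bounded by P d
   outright, without geometric growth. *)
pose B := 8 * 1 + 2 * (1 / T).
have P0 : 0 <= P by apply: sumr_ge0 => w _; exact: nrm_ge0.
have G0 : 0 <= G by apply: sumr_ge0 => w _; exact: nrm_ge0.
have gG w : (weight w <= N)%N -> nrm (g w) <= G.
  rewrite -mem_low_words => wN; rewrite /G (big_rem w)//= lerDl.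
  by apply: sumr_ge0 => i _; exact: nrm_ge0.
have T1 : 0 < 1 / T by rewrite divr_gt0.
have B1 : 1 <= B by rewrite /B; lra.
(* The low coefficients of [b] are at most P d B^N, so each integration costs a factor d Q. *)
pose Q := P * B ^+ N * T.
have BN0 : 0 <= B ^+ N by rewrite exprn_ge0//; lra.
have Q0 : 0 <= Q by rewrite /Q mulr_ge0 ?(ltW T0)// mulr_ge0.
(* With d S = min(1, e), the four summands give in turn: the error of [E T a], the condition P d <=
   1 of [correction_bound], the condition d Q <= 1, and the error made by multiplying with
   [E T b]. *)
pose S := 1 + P + Q + N%:R * ((G + 1) * Q).
have NQ0 : 0 <= N%:R * ((G + 1) * Q) :> R by rewrite mulr_ge0// mulr_ge0//; lra.
have S1 : 1 <= S by rewrite /S; lra.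
pose m := Num.min 1 e.
have m0 : 0 < m by rewrite lt_min ltr01.
have m1 : m <= 1 by rewrite ge_min lexx.
have me : m <= e by rewrite ge_min lexx orbT.
pose d := m / S.
have d0 : 0 < d by rewrite divr_gt0//; lra.
have dS : d * S = m by rewrite /d mulfVK// gt_eqF//; lra.
have dN0 : 0 <= d * (N%:R * ((G + 1) * Q)) by rewrite mulr_ge0// ltW.
have dP : 0 <= P * d by rewrite mulr_ge0// ltW.
have dQ : 0 <= d * Q by rewrite mulr_ge0// ltW.
have dS' : d + P * d + d * Q + d * (N%:R * ((G + 1) * Q)) = m by rewrite -dS /S; ring.
have d1 : d <= 1 by lra.
have Pd1 : P * d <= 1 by lra.
have dQ1 : d * Q <= 1 by lra.
have [_ [a Xa <-] ag] := (closure_coefP _ _).1 Gg.2 N d d0.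
have ag' w : (weight w <= N)%N -> nrm (E T a w - g w) <= d by move=> /ag/ltW.
have [b bq] := correction_exists T (fun n => return_coef T a n 0).
have Xb : X T b by exact: X_correction bq.
exists (E T (path_cat T b a)).
  exists (path_cat T b a) => //; split; first exact: X_cat.
  exact: correction_center bq.
have bsmall j : (j < N)%N ->
    {ae mu, forall x, 0 <= x <= T -> nrm (b j x) <= P * d * B ^+ N}.
  move=> jN; apply: aeW => x xT.
  have := correction_bound T0 bq (K := 1) (d := P * d) (N := N) (lexx _) dP Pd1.
  move=> H; apply: le_trans (H _ j x jN xT) _.
    by move=> k kN; rewrite expr1n mulr1; exact: (return_coef_small Xa cg ag' kN).
  rewrite ler_wpM2l// -/B ler_weXn2l//.
have Eb w : (0 < size w)%N -> (weight w <= N)%N -> nrm (E T b w) <= d * Q.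
  move=> w0 wN; rewrite E_pathc//.
  have eta0 : 0 <= P * d * B ^+ N by rewrite mulr_ge0.
  have TT : 0 <= T <= T by rewrite lexx ltW.
  have wl j : j \in w -> (j < N)%N by move=> /letter_lt_weight jw; exact: leq_trans wN.
  apply: le_trans (pathc_small T0 Xb eta0 wl bsmall TT) _.
  have -> : P * d * B ^+ N * T = d * Q by rewrite /Q; ring.
  (* The word is nonempty and d Q <= 1, so the power is at most its base. *)
  by rewrite -[leRHS]expr1 ler_wiXn2l.
move=> w wN; rewrite E_cat//.
have sub k : (weight (take k w) <= N)%N /\ (weight (drop k w) <= N)%N.
  by split; apply: leq_trans wN; rewrite (weight_take_drop k w) ?leq_addr ?leq_addl.
have H : nrm (ncmul (E T a) (E T b) w - E T a w) <= (size w)%:R * ((G + 1) * (d * Q)).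
  apply: ncmul_near => //; first by rewrite E_pathc.
  - lra.
  - move=> k; have [kN _] := sub k.
    rewrite -[E T a _](subrK (g (take k w))) addrC (le_trans (nrmD _ _))// lerD ?gG//.
    by rewrite (le_trans (ag' _ kN)).
  - by move=> k kw; apply: Eb; [rewrite size_drop subn_gt0|have [] := sub k].
have Hs : (size w)%:R * ((G + 1) * (d * Q)) <= N%:R * ((G + 1) * (d * Q)).
  rewrite ler_wpM2r ?ler_nat ?(leq_trans (size_le_weight w))//.
  by rewrite mulr_ge0//; lra.
have -> : ncmul (E T a) (E T b) w - g w =
  (ncmul (E T a) (E T b) w - E T a w) + (E T a w - g w) by ring.
rewrite (le_lt_trans (nrmD _ _))//.
have := ag w wN.
have : N%:R * ((G + 1) * (d * Q)) = d * (N%:R * ((G + 1) * Q)) by ring.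
lra.
Qed.

End Centers.

Theorem proposition3p6 (R : realType) (T : R) (hT : 0 < T) :
  is_dense_subgroup (Chat_f T) (Chat T).
Proof.
by split; [exact: Chat_sub|exact: Chat_subgroup|exact: Chat_dense].
Qed.
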